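(* Let $a$ and $q$ be indeterminates and for every integer $k\ge 0$ let \[ c_q(k)=\frac{(aq;q^2)_k\, (q/a;q^2)_k\, (q;q^2)_{2k}}{(aq^6;q^6)_k\, (q^6/a;q^6)_k\, (q^2;q^2)_{2k}}\,[8k+1]\, q^{2k^2}, \] and \[ a_q(k)=\sum_{j=0}^{k} c_q(j)\, c_q(k-j). \] Then for every positive integer $n$ coprime to $6$, \[ \sum_{k=0}^{n-1} a_q(k)\equiv q^{-(n-1)}[n]^2 \pmod{[n](1-aq^n)(a-q^n)}. \]
   Context: The $q$-shifted factorial is $(x;q)_0=1$ and $(x;q)_m=\prod_{i=0}^{m-1}(1-xq^i)$ for $m\ge1$. The $q$-integer is $[n]=\frac{1-q^n}{1-q}=1+q+\cdots+q^{n-1}$. Congruences are between rational functions (here in $a$ and $q$, with integer coefficients): $A/B\equiv 0\pmod P$ means $P$ divides $A$ and $\gcd(P,B)=1$, and $X\equiv Y\pmod P$ means $X-Y\equiv0\pmod P$. *)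

(* Defs.v *)
From mathcomp Require Import all_boot all_order all_algebra.

Set Implicit Arguments.
Unset Strict Implicit.
Unset Printing Implicit Defensive.

Import GRing.Theory.
Local Open Scope ring_scope.

Definition qpoch (R : pzRingType) (x q : R) (m : nat) : R :=
  \prod_(i < m) (1 - x * q ^+ i).

(* The form 1 + q + ... + q^(n-1) also makes sense in a ring without division,
   where it is used for the modulus; see qintE for the quotient form. *)
Definition qint (R : pzRingType) (q : R) (n : nat) : R := \sum_(i < n) q ^+ i.

Lemma qintE (F : fieldType) (q : F) (n : nat) :
  q != 1 -> qint q n = (1 - q ^+ n) / (1 - q).
Proof.
move=> q_neq1; have nz : 1 - q != 0 by rewrite subr_eq0 eq_sym.
apply: (mulIf nz); rewrite divfK // mulrC -[1 - q]opprB -[RHS]opprB.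
by rewrite subrX1 mulNr.
Qed.

Definition c_q (F : fieldType) (a q : F) (k : nat) : F :=
  qpoch (a * q) (q ^+ 2) k * qpoch (q / a) (q ^+ 2) k
    * qpoch q (q ^+ 2) (2 * k)
  / (qpoch (a * q ^+ 6) (q ^+ 6) k * qpoch (q ^+ 6 / a) (q ^+ 6) k
     * qpoch (q ^+ 2) (q ^+ 2) (2 * k))
  * qint q (8 * k + 1) * q ^+ (2 * k ^ 2).

Definition a_q (F : fieldType) (a q : F) (k : nat) : F :=
  \sum_(j < k.+1) c_q a q j * c_q a q (k - j).

(* Divisibility and coprimality in the ring R itself: gcdp and %| of polydiv
   only see polynomials up to nonzero scalars, so over {poly {poly int}} they
   would treat every nonzero element of {poly int} as invertible. *)
Definition dvdR (R : idomainType) (d x : R) : Prop := exists y, x = d * y.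

Definition coprimeR (R : idomainType) (x y : R) : Prop :=
  forall d : R, dvdR d x -> dvdR d y -> d \is a GRing.unit.

Definition frac_eqmod (R : idomainType) (X Y : {fraction R}) (P : R) : Prop :=
  exists A B : R,
    [/\ B != 0, X - Y = FracField.tofrac A / FracField.tofrac B,
        dvdR P A & coprimeR P B].

(* Z[a, q] as Z[a][q]: the inner variable is a, the outer one is q. *)
Notation Zaq := {poly {poly int}}.
Definition a_var : Zaq := 'X%:P.
Definition q_var : Zaq := 'X.

(* Main.v *)
From HB Require Import structures.
Require Import Defs.
From mathcomp Require Import all_boot all_order all_algebra all_field.
From mathcomp Require Import ring zify.

(** Let [S(a)] be the sum of the [c_q(k)], truncated where the summand vanishes.
    Creative telescoping gives [S(a q^6) (1 - a) q^3 = S(a) (1 - a q^6)].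

    - When [a = q^(-n)] or [a = q^n] the sum terminates at [(n-1)/2], and the recurrence
      yields [S = +- q^(-(n-1)/2) [n]]; the double sum is then [S^2].
    - When [q] is a root of unity of order [d > 1], [d | n], the nonzero [c_q(k)]
      split into runs, indexed by the quotient of [2k] by [d].  The sum over a run,
      with denominators cleared, is a polynomial in [a] satisfying the recurrence,
      which propagates one zero [a = q^m] to more zeros than the degree allows.  So each run
      sums to [0]; the condition [i + j < n] only depends on the runs
      of [i] and [j], and the double sum vanishes.

    The modulus, as a polynomial in [q] over an algebraically closed field containing
    [Z[a]], has simple roots, which are of these kinds, and is primitive over [Z[a]]:
    hence the congruence amounts to the vanishing of the difference of both sides at every
    root. *)

Set Implicit Arguments.
Unset Strict Implicit.
Unset Printing Implicit Defensive.

Import GRing.Theory.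
Local Open Scope ring_scope.

(** * The telescoping recurrence *)

Section Telescoping.
Variables (R : idomainType) (q y : R) (w : nat -> R).

(* [xk k] is the value of [q ^ (2 j)] at [j = j0 + k] when [y = q ^ (2 j0)]: the summand is
   studied on runs of indices starting at [j0], with [w] collecting the factors free of [a]. *)
Definition xk k := y * q ^+ (2 * k).
Definition numk (a : R) k := \prod_(i < k) ((1 - a * q * xk i) * (a - q * xk i)).
Definition denk (a : R) k :=
  \prod_(i < k) ((1 - a * q ^+ 6 * xk i ^+ 3) * (a - q ^+ 6 * xk i ^+ 3)).

(* [denk a K] times the sum over [k <= K] of [numk a k / denk a k * w k * (1 - q * xk k ^+ 4)],
   see [Wsum_denk]: clearing denominators makes it a polynomial in [a] of degree at most [2 K]. *)
Fixpoint Wsum (a : R) K := match K with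
  | 0 => w 0 * (1 - q * xk 0 ^+ 4)
  | K'.+1 => Wsum a K' * ((1 - a * q ^+ 6 * xk K' ^+ 3) * (a - q ^+ 6 * xk K' ^+ 3))
           + numk a K'.+1 * (w K'.+1 * (1 - q * xk K'.+1 ^+ 4))
  end.

(** A common core of [numk a] and [numk (a * q ^+ 6)]: the factor [1 - a q x] comes from the former,
    [a q^5 - x] from the latter up to a power of [q]. *)
Definition comk (a : R) k := \prod_(i < k) ((1 - a * q * xk i) * (a * q ^+ 5 - xk i)).

Lemma WsumS a K : Wsum a K.+1
  = Wsum a K * ((1 - a * q ^+ 6 * xk K ^+ 3) * (a - q ^+ 6 * xk K ^+ 3))
    + numk a K.+1 * (w K.+1 * (1 - q * xk K.+1 ^+ 4)).
Proof. by []. Qed.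

Lemma xk0 : xk 0 = y.
Proof. by rewrite /xk muln0 expr0 mulr1. Qed.

Lemma xkS k : xk k.+1 = xk k * q ^+ 2.
Proof. by rewrite /xk mulnS addnC exprD mulrA. Qed.

(** Replacing [a] by [a q^6] moves the factor [1 - a q x_i] to index [i + 3], so the two products
    differ by three factors at each end. The other factor behaves likewise in [comk_numk]. *)
Lemma numk_comk a k :
  numk (a * q ^+ 6) k
    * ((1 - a * q * y) * (1 - a * q ^+ 3 * y) * (1 - a * q ^+ 5 * y))
  = q ^+ k * comk a k * ((1 - a * q * xk k) * (1 - a * q ^+ 3 * xk k)
                         * (1 - a * q ^+ 5 * xk k)).
Proof.
elim: k => [|k IHk]; first by rewrite /numk /comk !big_ord0 xk0 expr0; ring.
rewrite /numk /comk !big_ord_recr /= -/(numk _ k) -/(comk _ k).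
set z := numk _ k in IHk *; set e := (X in z * X = _) in IHk; rewrite -/e.
by rewrite mulrAC IHk xkS (exprS q k); ring.
Qed.

Lemma comk_numk a k :
  q ^+ k ^+ 5 * numk a k
    * ((a * q ^+ 5 - y) * (a * q ^+ 3 - y) * (a * q - y))
  = comk a k * ((a * q ^+ 5 - xk k) * (a * q ^+ 3 - xk k) * (a * q - xk k)).
Proof.
elim: k => [|k IHk]; first by rewrite /numk /comk !big_ord0 xk0 expr0; ring.
rewrite /numk /comk !big_ord_recr /= -/(numk _ k) -/(comk _ k).
set z := (X in q ^+ k.+1 ^+ 5 * X * _).
transitivity ((q ^+ k ^+ 5 * numk a k
    * ((a * q ^+ 5 - y) * (a * q ^+ 3 - y) * (a * q - y))) *
   (q ^+ 5 * ((1 - a * q * xk k) * (a - q * xk k)))).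
  by rewrite /z (exprS q k); ring.
by rewrite IHk xkS; ring.
Qed.

Hypothesis y1q : (y == 1) || (y == q).

(* The last summand is the Gosper certificate, up to the common denominator; it vanishes when
   the sum stops at its natural boundary.  Its vanishing at the lower end is what forces
   [y = 1] or [y = q]. *)
Lemma telescope_Wsum a K :
  (forall k, (k < K)%N -> w k.+1 * ((1 - q ^+ 2 * xk k ^+ 2) * (1 - q ^+ 4 * xk k ^+ 2))
    = w k * ((1 - q * xk k ^+ 2) * (1 - q ^+ 3 * xk k ^+ 2) * (q ^+ 2 * xk k ^+ 2))) ->
  (forall k, (k < K)%N -> (1 - q ^+ 2 * xk k ^+ 2) * (1 - q ^+ 4 * xk k ^+ 2) != 0) ->
  Wsum (a * q ^+ 6) K
    * ((1 - a * q * y) * (1 - a * q ^+ 3 * y) * (1 - a * q ^+ 5 * y))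
    * ((a - xk K ^+ 3) * q ^+ 3)
  = q ^+ K ^+ 6 * Wsum a K
    * ((a * q ^+ 5 - y) * (a * q ^+ 3 - y) * (a * q - y)) * (1 - a * q ^+ 6 * xk K ^+ 3)
  + q ^+ K * comk a K * w K
    * ((a ^+ 2 * q ^+ 6 - 1) * (1 - a * q * xk K) * (a * q ^+ 5 - xk K)
       * ((1 - q * xk K ^+ 2) * (1 - q ^+ 3 * xk K ^+ 2)) * xk K ^+ 2).
Proof.
elim: K => [|K IHK] wS v_neq0.
  rewrite /= /comk big_ord0 xk0 !expr0.
  by case/orP: y1q => /eqP ->; ring.
have {}IHK := IHK (fun k lekK => wS k (ltnW lekK)) (fun k lekK => v_neq0 k (ltnW lekK)).
have wSK := wS K (leqnn _); apply: (mulIf (v_neq0 K (leqnn _))).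
have sh := numk_comk a K.+1; have us := comk_numk a K.+1.
move: IHK sh us wSK; rewrite /= /comk !big_ord_recr /= -/(comk _ K) !xkS (exprS q K).
set W1 := Wsum _ K; set W0 := Wsum _ K; set N1 := numk _ _; set N0 := numk _ _.
set e1 := (1 - a * q * y) * _ * _; set e2 := (_ - y) * _ * _.
set x := xk K; set v := (1 - q ^+ 2 * x ^+ 2) * _.
set u := _ * (q ^+ 2 * x ^+ 2); set t := q ^+ K; set C := comk a K.
move=> IHK sh us wSK.
(* Both sides are regrouped so that the induction hypothesis, the two shift identities and the
   recurrence of [w] apply; a polynomial identity remains. *)
have -> : (W1 * ((1 - a * q ^+ 6 * q ^+ 6 * x ^+ 3) * (a * q ^+ 6 - q ^+ 6 * x ^+ 3)) +
    N1 * (w K.+1 * (1 - q * (x * q ^+ 2) ^+ 4))) * e1 * ((a - (x * q ^+ 2) ^+ 3) * q ^+ 3) * v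
  = (W1 * e1 * ((a - x ^+ 3) * q ^+ 3)) * ((1 - a * q ^+ 6 * q ^+ 6 * x ^+ 3) * q ^+ 6 *
      (a - (x * q ^+ 2) ^+ 3)) * v + (N1 * e1) * (w K.+1 * v) * ((1 - q * (x * q ^+ 2) ^+ 4)) *
     ((a - (x * q ^+ 2) ^+ 3) * q ^+ 3) by ring.
rewrite IHK sh.
have -> : (q * t) ^+ 6 *
 (W0 * ((1 - a * q ^+ 6 * x ^+ 3) * (a - q ^+ 6 * x ^+ 3)) +
  N0 * (w K.+1 * (1 - q * (x * q ^+ 2) ^+ 4))) * e2 * (1 - a * q ^+ 6 * (x * q ^+ 2) ^+ 3)
  = (t ^+ 6 * W0 * e2 * (1 - a * q ^+ 6 * x ^+ 3)) * (q ^+ 6 * (a - q ^+ 6 * x ^+ 3) *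
       (1 - a * q ^+ 6 * (x * q ^+ 2) ^+ 3)) +
   ((q * t) ^+ 5 * N0 * e2) * w K.+1 * (q * t * (1 - q * (x * q ^+ 2) ^+ 4) *
       (1 - a * q ^+ 6 * (x * q ^+ 2) ^+ 3)) by ring.
rewrite us [in RHS]mulrDl [in RHS]mulrDl.
have -> (X Y : R) : X * w K.+1 * Y * v = X * Y * (w K.+1 * v) by ring.
have -> (X Y : R) : X * w K.+1 * Y * v = X * Y * (w K.+1 * v) by ring.
rewrite wSK /u /v.
by ring.
Qed.

End Telescoping.

(** * The summand as a hypergeometric term *)

(** The cubes [x_i^3] advance by [q^6], so the shift of [a] moves the index by one only and leaves
    one factor at each end. *)
Lemma denk_shift (R : idomainType) (q y a : R) k :
  denk q y (a * q ^+ 6) k * ((1 - a * q ^+ 6 * y ^+ 3) * (a - xk q y k ^+ 3))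
  = q ^+ k ^+ 6 * denk q y a k
    * ((1 - a * q ^+ 6 * xk q y k ^+ 3) * (a - y ^+ 3)).
Proof.
elim: k => [|k IHk]; first by rewrite /denk !big_ord0 xk0 expr0; ring.
rewrite /denk !big_ord_recr /= -!/(denk _ _ _ k).
set x := xk q y k in IHk *; set z := denk _ _ _ k in IHk *.
rewrite xkS -/x (exprS q k).
transitivity ((z * ((1 - a * q ^+ 6 * y ^+ 3) * (a - x ^+ 3))) * (q ^+ 6 *
   ((1 - a * q ^+ 6 * q ^+ 6 * x ^+ 3) * (a - (x * q ^+ 2) ^+ 3)))); first by ring.
by rewrite IHk; ring.
Qed.

Lemma qpoch_add (R : comNzRingType) (x q : R) m k :
  qpoch x q (m + k) = qpoch x q m * qpoch (x * q ^+ m) q k.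
Proof.
rewrite /qpoch big_split_ord /=; congr (_ * _).
by apply: eq_bigr => i _; rewrite exprD mulrA.
Qed.

Section Weight.
Variables (L : fieldType) (q : L) (b : nat -> L).

(** Of the exponent [2 (j0 + k)^2] the part [2 j0^2] is left out, being constant along the run. *)
Definition weight j0 k := b (2 * (j0 + k)) * q ^+ (2 * k ^ 2) * q ^+ (4 * j0 * k).

Hypothesis bS : forall m, b m.+1 * (1 - q ^+ (2 * m + 2)) = b m * (1 - q ^+ (2 * m + 1)).

(** Two steps of [bS], since [b] is read at even indices; this is the relation that [telescope_Wsum]
    asks of [w]. *)
Lemma weightS j0 k (x := xk q (q ^+ (2 * j0)) k) :
  weight j0 k.+1 * ((1 - q ^+ 2 * x ^+ 2) * (1 - q ^+ 4 * x ^+ 2))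
  = weight j0 k * ((1 - q * x ^+ 2) * (1 - q ^+ 3 * x ^+ 2) * (q ^+ 2 * x ^+ 2)).
Proof.
rewrite /weight; set m := (2 * (j0 + k))%N.
have b1 := bS m; have b2 := bS m.+1.
have xE i : q ^+ (2 * m + i) = q ^+ i * x ^+ 2.
  by rewrite /x /xk -exprD -exprM -exprD; congr (_ ^+ _); lia.
have e2 : (2 * m.+1 + 2 = 2 * m + 4)%N by lia.
have e1 : (2 * m.+1 + 1 = 2 * m + 3)%N by lia.
rewrite e1 e2 !xE in b2; rewrite !xE expr1 in b1.
have -> : (2 * (j0 + k.+1) = m.+2)%N by lia.
have pE : q ^+ (2 * k.+1 ^ 2) * q ^+ (4 * j0 * k.+1)
   = (q ^+ (2 * k ^ 2) * q ^+ (4 * j0 * k)) * (q ^+ 2 * x ^+ 2).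
  by rewrite /x /xk -!exprD -exprM -!exprD; congr (_ ^+ _); lia.
rewrite -[b m.+2 * _ * _]mulrA pE.
transitivity ((b m.+2 * (1 - q ^+ 4 * x ^+ 2)) * (1 - q ^+ 2 * x ^+ 2)
  * ((q ^+ (2 * k ^ 2) * q ^+ (4 * j0 * k)) * (q ^+ 2 * x ^+ 2))); first by ring.
rewrite b2.
transitivity ((b m.+1 * (1 - q ^+ 2 * x ^+ 2)) * (1 - q ^+ 3 * x ^+ 2)
  * ((q ^+ (2 * k ^ 2) * q ^+ (4 * j0 * k)) * (q ^+ 2 * x ^+ 2))); first by ring.
by rewrite b1; ring.
Qed.

End Weight.

Section Terms.
Variables (L : fieldType) (a q : L) (b : nat -> L).

(* [c_q] with the ratio of [(q; q^2)_m] and [(q^2; q^2)_m] at [m = 2 k] abstracted as [b m], so that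
   [b] can be given a value at the roots of unity, where both symbols vanish. *)
Definition cterm k : L :=
  qpoch (a * q) (q ^+ 2) k * qpoch (q / a) (q ^+ 2) k
  / (qpoch (a * q ^+ 6) (q ^+ 6) k * qpoch (q ^+ 6 / a) (q ^+ 6) k)
  * b (2 * k) * qint q (8 * k + 1) * q ^+ (2 * k ^ 2).

Hypotheses (a_neq0 : a != 0) (q_neq1 : q != 1).

Lemma numk_qpoch y k :
  qpoch (a * q * y) (q ^+ 2) k * qpoch (q / a * y) (q ^+ 2) k
  = numk q y a k / a ^+ k.
Proof.
rewrite /qpoch /numk -big_split /= -[X in a ^+ X]card_ord -prodr_const -prodf_div.
apply: eq_bigr => i _; rewrite /xk exprM; set x := (q ^+ 2) ^+ i.
by field.
Qed.

Lemma denk_qpoch y k :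
  qpoch (a * q ^+ 6 * y ^+ 3) (q ^+ 6) k * qpoch (q ^+ 6 / a * y ^+ 3) (q ^+ 6) k
  = denk q y a k / a ^+ k.
Proof.
rewrite /qpoch /denk -big_split /= -[X in a ^+ X]card_ord -prodr_const -prodf_div.
apply: eq_bigr => i _.
have -> : (q ^+ 6) ^+ i = q ^+ (2 * i) ^+ 3 by rewrite -!exprM; congr (_ ^+ _); lia.
rewrite /xk; set x := q ^+ (2 * i).
by field.
Qed.

(** Splits off what is constant along the run starting at [j0]. The powers of [a] produced by
    [q / a] and [q^6 / a] cancel between numerator and denominator. *)
Lemma cterm_block j0 k :
  cterm (j0 + k)
  = qpoch (a * q) (q ^+ 2) j0 * qpoch (q / a) (q ^+ 2) j0
    / (qpoch (a * q ^+ 6) (q ^+ 6) j0 * qpoch (q ^+ 6 / a) (q ^+ 6) j0)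
    * q ^+ (2 * j0 ^ 2) / (1 - q)
    * (numk q (q ^+ (2 * j0)) a k / denk q (q ^+ (2 * j0)) a k
       * (weight q b j0 k * (1 - q * xk q (q ^+ (2 * j0)) k ^+ 4))).
Proof.
rewrite /cterm !qpoch_add qintE //.
have -> : (q ^+ 2) ^+ j0 = q ^+ (2 * j0) by rewrite exprM.
have -> : (q ^+ 6) ^+ j0 = (q ^+ (2 * j0)) ^+ 3.
  by rewrite -!exprM; congr (_ ^+ _); lia.
set y := q ^+ (2 * j0).
have -> : q ^+ (8 * (j0 + k) + 1) = q * xk q y k ^+ 4.
  by rewrite /xk /y -exprD -exprM -exprS; congr (_ ^+ _); lia.
have -> : q ^+ (2 * (j0 + k) ^ 2) = q ^+ (2 * j0 ^ 2) * (q ^+ (2 * k ^ 2) * q ^+ (4 * j0 * k)).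
  by rewrite -!exprD; congr (_ ^+ _); lia.
have nE := numk_qpoch y k; have dE := denk_qpoch y k.
have ak0 : a ^+ k != 0 by rewrite expf_neq0.
have -> : numk q y a k / denk q y a k = (numk q y a k / a ^+ k) / (denk q y a k / a ^+ k).
  by rewrite invfM invrK mulrACA mulVf ?mulr1.
rewrite -nE -dE /weight !invfM.
by ring.
Qed.

Lemma Wsum_denk y w K : denk q y a K != 0 ->
  Wsum q y w a K = denk q y a K
    * \sum_(k < K.+1) numk q y a k / denk q y a k * (w k * (1 - q * xk q y k ^+ 4)).
Proof.
elim: K => [|K IHK] dnz.
  by rewrite big_ord1 /numk /denk !big_ord0 divr1 !mul1r.
rewrite WsumS big_ord_recr /= [RHS]mulrDr [RHS]addrC [LHS]addrC; congr (_ + _).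
  by rewrite [RHS]mulrA [denk _ _ _ _ * (_ / _)]mulrC divfK.
move: dnz; have -> : denk q y a K.+1 = denk q y a K
    * ((1 - a * q ^+ 6 * xk q y K ^+ 3) * (a - q ^+ 6 * xk q y K ^+ 3)).
  by rewrite /denk big_ord_recr.
by rewrite mulf_eq0 => /norP[dnz _]; rewrite /= IHK // mulrAC.
Qed.

Lemma sum_cterm_block j0 K (y := q ^+ (2 * j0)) : denk q y a K != 0 ->
  \sum_(k < K.+1) cterm (j0 + k)
  = qpoch (a * q) (q ^+ 2) j0 * qpoch (q / a) (q ^+ 2) j0
    / (qpoch (a * q ^+ 6) (q ^+ 6) j0 * qpoch (q ^+ 6 / a) (q ^+ 6) j0)
    * q ^+ (2 * j0 ^ 2) / (1 - q) * (Wsum q y (weight q b j0) a K / denk q y a K).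
Proof.
move=> dnz; rewrite Wsum_denk // [denk _ _ _ _ * _]mulrC mulfK // mulr_sumr.
by apply: eq_bigr => k _; rewrite cterm_block.
Qed.

End Terms.

(** The factor of index [(n - 1) / 2] in the first symbol is [1 - q^(-n) q^n]. *)
Lemma cterm_eq0 (L : fieldType) (q : L) b n k : q != 0 -> odd n -> (n <= 2 * k)%N ->
  cterm (q ^- n) q b k = 0.
Proof.
move=> q_neq0 n_odd le_n_2k; rewrite /cterm /qpoch.
have lt_nk : (n./2 < k)%N by lia.
rewrite (bigD1 (Ordinal lt_nk)) //=.
have -> : q ^- n * q * (q ^+ 2) ^+ n./2 = 1.
  rewrite -exprM -mulrA -exprS (_ : (2 * n./2).+1 = n) ?mulVf ?expf_neq0 //.
  by lia.
by rewrite subrr !mul0r.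
Qed.

(** * The terminating sum at [a = q^(-n)], for [q] not a root of unity *)

Section Generic.
Variables (L : fieldType) (q : L) (b : nat -> L).
Hypotheses (q_neq0 : q != 0) (q_nonroot : forall m, (0 < m)%N -> q ^+ m != 1).
Hypothesis b0 : b 0%N = 1.
Hypothesis bS : forall m, b m.+1 * (1 - q ^+ (2 * m + 2)) = b m * (1 - q ^+ (2 * m + 1)).

Lemma expr_nonroot_inj i j : q ^+ i = q ^+ j -> i = j.
Proof.
wlog le_ij : i j / (i <= j)%N => [wl eq_q|].
  by case/orP: (leq_total i j) => le_ij; [|apply/esym]; apply: wl.
rewrite -(subnKC le_ij) exprD -{1}[q ^+ i]mulr1 => /(mulfI (expf_neq0 _ q_neq0)) eq1.
case: (posnP (j - i)) => [->|/q_nonroot]; first by rewrite addn0.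
by rewrite -eq1 eqxx.
Qed.

(** A zero of a first factor would make the odd [n] a multiple of 6; a zero of a second one would
    make a positive power of [q] equal to 1. *)
Lemma denk_nonroot n K : odd n -> (n %% 3 != 0)%N -> denk q 1 (q ^- n) K != 0.
Proof.
move=> n_odd n_co3; apply/prodf_neq0 => i _; rewrite /xk mul1r.
have qn0 : q ^+ n != 0 by rewrite expf_neq0.
rewrite mulf_eq0 !subr_eq0 negb_or -exprM.
apply/andP; split; apply/eqP => eq1.
  have /expr_nonroot_inj : q ^+ n = q ^+ (6 + 2 * i * 3).
    apply: (mulfI (invr_neq0 qn0)); rewrite mulVf // exprD mulrA. exact: eq1.
  by lia.
have : q ^+ (n + (6 + 2 * i * 3)) = 1 by rewrite !exprD -eq1 mulfV.
by apply/eqP; apply: q_nonroot; rewrite addn_gt0 orbT.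
Qed.

(** The recurrence under [a -> a q^6] at [a = q^(-n)]: [telescope_Wsum] without its boundary term,
    divided by [denk_shift]. *)
Lemma sum_cterm_shift n K : odd n -> (n %% 3 != 0)%N -> (7 <= n)%N -> (n <= 2 * K + 1)%N ->
  (\sum_(k < K.+1) cterm (q ^- n) q b k) * (1 - q ^- (n - 6))
  = q ^+ 3 * (1 - q ^- n) * \sum_(k < K.+1) cterm (q ^- (n - 6)) q b k.
Proof.
move=> n_odd n_co3 n_ge7 le_nK; set a := q ^- n.
have qn0 m : q ^+ m != 0 by rewrite expf_neq0.
have a6 : q ^- (n - 6) = a * q ^+ 6.
  rewrite /a -[in RHS](subnK (ltnW n_ge7)) exprD invfM -mulrA mulVf ?mulr1 //.
have a0 : a != 0 by rewrite invr_neq0.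
have q1 : q != 1 by rewrite -[q]expr1 q_nonroot.
have n6_odd : odd (n - 6) by lia.
have n6_co3 : ((n - 6) %% 3 != 0)%N by lia.
have dnz := denk_nonroot K n_odd n_co3; have dnz6 := denk_nonroot K n6_odd n6_co3.
have sumE n' : denk q 1 (q ^- n') K != 0 -> \sum_(k < K.+1) cterm (q ^- n') q b k
   = Wsum q 1 (weight q b 0) (q ^- n') K / denk q 1 (q ^- n') K / (1 - q).
  have n'0 : q ^- n' != 0 by rewrite invr_neq0.
  move=> dn'; have := @sum_cterm_block _ (q ^- n') q b n'0 q1 0 K.
  rewrite (_ : (2 * 0)%N = 0%N) // expr0 => /(_ dn') ->.
  by rewrite /qpoch !big_ord0 !mulr1 invr1 !mul1r mulrC.
rewrite !sumE ?a6 -?a6 // a6 -/a; rewrite a6 -/a in dnz6; set x := xk q 1 K.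
have xq : x = q ^+ (2 * K) by rewrite /x /xk mul1r.
(* For [y = 1] the lower-end factors of the two sides are opposite; their cancellation produces the
   sign. *)
have tel : Wsum q 1 (weight q b 0) (a * q ^+ 6) K * ((a - x ^+ 3) * q ^+ 3)
   = - (q ^+ K ^+ 6 * Wsum q 1 (weight q b 0) a K * (1 - a * q ^+ 6 * x ^+ 3)).
  have v_neq0 k : (1 - q ^+ 2 * xk q 1 k ^+ 2) * (1 - q ^+ 4 * xk q 1 k ^+ 2) != 0.
    rewrite /xk mul1r -exprM -!exprD mulf_neq0 // subr_eq0 eq_sym q_nonroot //.
  have wS k := weightS bS 0 k; rewrite (_ : (2 * 0)%N = 0%N) // expr0 in wS.
  have y1 : ((1 : L) == 1) || ((1 : L) == q) by rewrite eqxx.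
  have := @telescope_Wsum _ q 1 (weight q b 0) y1 a K (fun k _ => wS k) (fun k _ => v_neq0 k).
  rewrite -/x !mulr1.
  set C := comk _ _ _ _; set w := weight _ _ _ _.
  have -> : q ^+ K * C * w * ((a ^+ 2 * q ^+ 6 - 1) * (1 - a * q * x) * (a * q ^+ 5 - x) *
     ((1 - q * x ^+ 2) * (1 - q ^+ 3 * x ^+ 2)) * x ^+ 2) = 0.
    (* [C] holds the factors [1 - a q^(2i+1)] with [i < K] and the certificate adds [i = K], so the
       vanishing one, [i = n./2 <= K], is among them. *)
    have C0 : C * (1 - a * q * x) = 0.
      have lt_nK : (n./2 < K.+1)%N by lia.
      have -> : C * (1 - a * q * x) = \prod_(i < K.+1) (1 - a * q * q ^+ (2 * i))
           * \prod_(i < K) (a * q ^+ 5 - q ^+ (2 * i)).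
        rewrite /C /comk big_split /= big_ord_recr /= -xq mulrAC.
        by congr (_ * _ * _); apply: eq_bigr => i _; rewrite /xk mul1r.
      rewrite (bigD1 (Ordinal lt_nK)) //= -mulrA -exprS (_ : (2 * n./2).+1 = n); last by lia.
      by rewrite mulVf // subrr !mul0r.
    transitivity (C * (1 - a * q * x) * (q ^+ K * w * ((a ^+ 2 * q ^+ 6 - 1)
       * (a * q ^+ 5 - x) * ((1 - q * x ^+ 2) * (1 - q ^+ 3 * x ^+ 2)) * x ^+ 2))).
      by ring.
    by rewrite C0 mul0r.
  set W6 := Wsum _ _ _ (a * _) _; set W := Wsum _ _ _ a _.
  set e1 := (1 - a * q) * _ * _; rewrite addr0 => tel.
  (* A zero would give [n = 1], [3] or [5], but [n >= 7]. *)
  have e1_neq0 : e1 != 0.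
    rewrite /e1 -[q in 1 - a * q]expr1 !mulf_neq0 // subr_eq0; apply/eqP => eq1.
    - by have /expr_nonroot_inj : q ^+ n = q ^+ 1; [apply: (mulfI a0); rewrite mulVf|lia].
    - by have /expr_nonroot_inj : q ^+ n = q ^+ 3; [apply: (mulfI a0); rewrite mulVf|lia].
    - by have /expr_nonroot_inj : q ^+ n = q ^+ 5; [apply: (mulfI a0); rewrite mulVf|lia].
  apply: (mulfI e1_neq0); transitivity (W6 * e1 * ((a - x ^+ 3) * q ^+ 3)); first by ring.
  by rewrite tel /e1; ring.
have dsh := denk_shift q 1 a K.
set D6 := denk _ _ (a * _) _ in dsh dnz6 *; set D := denk _ _ a _ in dsh dnz *.
set W6 := Wsum _ _ _ (a * _) _ in tel *; set W := Wsum _ _ _ a _ in tel *.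
have q1' : 1 - q != 0 by rewrite subr_eq0 eq_sym.
have ax_neq0 : a - x ^+ 3 != 0.
  rewrite subr_eq0; apply: contra_neq (q_nonroot (m := n + 2 * K * 3) _).
    by move=> aE; rewrite exprD exprM -xq -aE mulfV.
  by lia.
suff WE : W * (1 - a * q ^+ 6) * D6 = q ^+ 3 * (1 - a) * W6 * D.
  transitivity (W * (1 - a * q ^+ 6) * D6 / (D * D6 * (1 - q))).
    by field; rewrite dnz dnz6 q1'.
  by rewrite WE; field; rewrite dnz dnz6 q1'.
apply: (mulIf ax_neq0); transitivity (W * (D6 * ((1 - a * q ^+ 6 * 1 ^+ 3) * (a - x ^+ 3)))).
  by ring.
rewrite dsh -/x; transitivity ((1 - a) * D * - (q ^+ K ^+ 6 * W * (1 - a * q ^+ 6 * x ^+ 3))).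
  by ring.
by rewrite -tel; ring.
Qed.

(** Induction from [n - 6] to [n = 2 K + 1], that is from [K - 3] to [K], by [sum_cterm_shift]. The
    step preserves the sign, which is fixed by the starting values [n = 1] and [n = 5]. *)
Lemma sum_cterm_closed K : ((2 * K + 1) %% 3 != 0)%N ->
  exists2 e, e ^+ 2 = 1 &
  (\sum_(k < K.+1) cterm (q ^- (2 * K + 1)) q b k) * (q ^+ K * (1 - q))
  = e * (1 - q ^+ (2 * K + 1)).
Proof.
have n1 m : (0 < m)%N -> 1 - q ^+ m != 0 by move=> m0; rewrite subr_eq0 eq_sym q_nonroot.
have q1 : q != 1 by rewrite -[q]expr1 q_nonroot.
elim/ltn_ind: K => K IHK nK.
case: (ltnP K 3) => [lt_K3|le_3K].
  (* [K = 1] would be [n = 3]. *)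
  have {lt_K3 nK IHK} : K = 0%N \/ K = 2%N by lia.
  case=> ->.
    exists 1; first by rewrite expr1n.
    rewrite big_ord1 /cterm /qpoch !big_ord0 /= muln0 b0 /qint big_ord1 !expr0.
    by rewrite !mulr1 invr1 !mul1r.
  (* The case [n = 5] is computed directly, with [b 1] to [b 4] expanded by [bS]. *)
  exists (-1); first by ring.
  rewrite !big_ord_recr big_ord0 /= /cterm !qintE // /qpoch !big_ord_recr !big_ord0 /=.
  rewrite !(expr0, muln0, muln1, mul1r) /= b0.
  have b1E : b 1%N = (1 - q ^+ 1) / (1 - q ^+ 2).
    by apply: (mulIf (n1 2%N _)); rewrite // (bS 0) b0 mul1r divfK ?n1.
  have b2E : b 2%N = b 1%N * (1 - q ^+ 3) / (1 - q ^+ 4).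
    by apply: (mulIf (n1 4%N _)); rewrite // (bS 1) divfK ?n1.
  have b3E : b 3%N = b 2%N * (1 - q ^+ 5) / (1 - q ^+ 6).
    by apply: (mulIf (n1 6%N _)); rewrite // (bS 2) divfK ?n1.
  have b4E : b 4%N = b 3%N * (1 - q ^+ 7) / (1 - q ^+ 8).
    by apply: (mulIf (n1 8%N _)); rewrite // (bS 3) divfK ?n1.
  rewrite [b (2 * 2)]b4E b3E b2E b1E.
  rewrite (_ : (2 * 2 + 1)%N = 5%N) // (_ : (8 + 1)%N = 9%N) // (_ : (8 * 2 + 1)%N = 17%N) //.
  rewrite (_ : (2 * 2 ^ 2)%N = 8%N) // (_ : (0 + 1)%N = 1%N) //.
  field; rewrite -!exprD -exprS !n1 // q_neq0 oner_neq0 andbT.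
  by rewrite -[q]expr1 n1.
have lt3 : (K - 3 < K)%N by lia.
have nK3 : ((2 * (K - 3) + 1) %% 3 != 0)%N by lia.
have [e e2 eT] := IHK _ lt3 nK3; exists e => //.
have n_odd : odd (2 * K + 1) by lia.
have n7 : (7 <= 2 * K + 1)%N by lia.
have := sum_cterm_shift n_odd nK n7 (leqnn _).
have -> : (2 * K + 1 - 6 = 2 * (K - 3) + 1)%N by lia.
(* The last three terms vanish by termination at [n - 6]. *)
have -> : \sum_(k < K.+1) cterm (q ^- (2 * (K - 3) + 1)) q b k
   = \sum_(k < (K - 3).+1) cterm (q ^- (2 * (K - 3) + 1)) q b k.
  have -> : K.+1 = ((K - 3).+1 + 3)%N by lia.
  rewrite big_split_ord /= [X in _ + X]big1 ?addr0 // => i _.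
  by apply: cterm_eq0; rewrite //; lia.
set T := \sum_(k < _) _; set T' := \sum_(k < _) _ in eT * => TT'.
have KE : q ^+ K = q ^+ (K - 3) * q ^+ 3 by rewrite -exprD; congr (_ ^+ _); lia.
have nE : q ^+ (2 * K + 1) = q ^+ (2 * (K - 3) + 1) * q ^+ 6.
  by rewrite -exprD; congr (_ ^+ _); lia.
rewrite KE nE; move: TT'; rewrite nE; set u := q ^+ (2 * _ + 1).
have u0 : u != 0 by rewrite expf_neq0.
have u1 : 1 - u != 0 by rewrite n1 // addn1.
move=> TT'; apply: (mulIf u1).
transitivity (- (T * (1 - u^-1)) * u * (q ^+ (K - 3) * q ^+ 3 * (1 - q))); first by field.
rewrite TT'; transitivity (- (T' * (q ^+ (K - 3) * (1 - q))) * u * q ^+ 6 * (1 - (u * q ^+ 6)^-1)).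
  by ring.
by rewrite eT -/u; field; rewrite q_neq0 u0.
Qed.

(** Squaring removes the sign left open in [sum_cterm_closed]. *)
Lemma sum_cterm_sqr n : odd n -> (n %% 3 != 0)%N ->
  (\sum_(k < (n./2).+1) cterm (q ^- n) q b k) ^+ 2 = q ^- (n - 1) * qint q n ^+ 2.
Proof.
move=> n_odd n_co3; have nE : (2 * n./2 + 1 = n)%N by lia.
have [|e e2] := @sum_cterm_closed n./2; rewrite nE //.
have q1 : q != 1 by rewrite -[q]expr1 q_nonroot.
have q1' : 1 - q != 0 by rewrite subr_eq0 eq_sym.
set T := \sum_(k < _) _ => eT; rewrite qintE //.
have -> : q ^+ (n - 1) = q ^+ n./2 ^+ 2 by rewrite -exprM; congr (_ ^+ _); lia.
have qn0 : q ^+ n./2 != 0 by rewrite expf_neq0.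
transitivity ((T * (q ^+ n./2 * (1 - q))) ^+ 2 / (q ^+ n./2 * (1 - q)) ^+ 2).
  by field; rewrite qn0 q1'.
by rewrite eT exprMn e2; field; rewrite qn0 q1'.
Qed.
End Generic.

(** * Roots of unity *)

Section WsumPoly.
Variables (L : fieldType) (q y : L) (w : nat -> L).

(** Here [a] is the indeterminate, so that zeros can be counted against the degree. *)
Definition Wpoly K : {poly L} := Wsum q%:P y%:P (fun k => (w k)%:P) 'X K.

Lemma xkC k : xk q%:P y%:P k = (xk q y k)%:P.
Proof. by rewrite /xk polyCM polyC_exp. Qed.

Lemma horner_numk (p : {poly L}) t k : (numk q%:P y%:P p k).[t] = numk q y p.[t] k.
Proof.
rewrite /numk horner_prod; apply: eq_bigr => i _.
by rewrite xkC !hornerE.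
Qed.

(** General [p], because the recurrence involves both ['X] and ['X * q^6]. *)
Lemma horner_Wsum (p : {poly L}) t K :
  (Wsum q%:P y%:P (fun k => (w k)%:P) p K).[t] = Wsum q y w p.[t] K.
Proof.
elim: K => [|K IHK]; first by rewrite /= xkC -!polyC_exp !hornerE.
rewrite !WsumS hornerD !(hornerM, horner_numk) IHK !xkC -!polyC_exp.
by rewrite !hornerE.
Qed.

Lemma size_Wpoly K : (size (Wpoly K) <= (2 * K).+1)%N.
Proof.
have sM (p r : {poly L}) m : (size p <= m.+1)%N -> (size r <= 3)%N -> (size (p * r)%R <= m.+3)%N.
  by move=> sp sr; have := size_polyMleq p r; lia.
have s1 (c e : L) : (size ((1 - 'X * c%:P) * ('X - e%:P))%R <= 3)%N.
  apply: leq_trans (size_polyMleq _ _) _.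
  have sX (u v : L) : (size (u%:P * 'X + v%:P)%R <= 2)%N.
    by rewrite size_MXaddC; case: ifP => // _; apply: size_polyC_leq1.
  have s2 : (size (1 - 'X * c%:P)%R <= 2)%N.
    by rewrite (_ : _ - _ = (- c)%:P * 'X + 1%:P) ?sX // polyCN polyC1; ring.
  have s3 : (size ('X - e%:P)%R <= 2)%N by rewrite size_XsubC.
  by have := leq_add s2 s3; case: (_ + _)%N.
have sN k : (size (numk q%:P y%:P 'X k) <= (2 * k).+1)%N.
  elim: k => [|k IHk]; first by rewrite /numk big_ord0 size_poly1.
  rewrite /numk big_ord_recr /= xkC mulnS -['X * _ * _]mulrA -polyCM.
  by apply: sM IHk _; apply: s1.
elim: K => [|K IHK].
  by rewrite /Wpoly /= xkC -!(polyC_exp, polyCM, polyCB, polyC1) size_polyC_leq1.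
rewrite /Wpoly WsumS; apply: leq_trans (size_polyD _ _) _; rewrite geq_max.
rewrite !xkC -!(polyC_exp, polyCM, polyCB, polyC1); apply/andP; split.
  rewrite mulnS; apply: sM IHK _.
  by rewrite -['X * _ * _]mulrA -polyCM; apply: s1.
by rewrite mulrC mul_polyC; apply: leq_trans (size_scale_leq _ _) (sN _).
Qed.
End WsumPoly.

Lemma prim_expr_inj (L : fieldType) (q : L) d (i j : nat) : d.-primitive_root q ->
  q ^+ i = q ^+ j -> (i < d)%N -> (j < d)%N -> i = j.
Proof.
move=> q_prim /eqP eq_ij lt_i lt_j; move: eq_ij.
by rewrite (eq_prim_root_expr q_prim) !modn_small // => /eqP.
Qed.

Section PrimitiveRoot.
Variables (L : fieldType) (q : L) (d : nat).
Hypotheses (q_prim : d.-primitive_root q) (d_odd : odd d) (d_co3 : (d %% 3 != 0)%N).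
Hypothesis d_gt1 : (1 < d)%N.

Lemma prim_root_expr_3 : d.-primitive_root (q ^+ 3).
Proof. by rewrite (prim_root_exp_coprime _ q_prim) prime_coprime // /dvdn. Qed.

Lemma prim_root_expr_6 : d.-primitive_root (q ^+ 6).
Proof.
rewrite (prim_root_exp_coprime _ q_prim) (_ : 6 = 2 * 3)%N // coprimeMl coprime2n d_odd.
by rewrite prime_coprime // /dvdn.
Qed.

Lemma prim_root_neq0 : q != 0.
Proof.
apply/eqP=> q0; have := prim_expr_order q_prim.
by rewrite q0 expr0n -[d]prednK ?(prim_order_gt0 q_prim) // => /eqP; rewrite eq_sym oner_eq0.
Qed.

Lemma expr_prim_neq1 m : ~~ (d %| m)%N -> q ^+ m != 1.
Proof. by rewrite (prim_order_dvd q_prim). Qed.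

(** The two forms of [d] make the certificate vanish at the upper end. The recurrence then gives the
    zero [a = x^3] and carries each zero [t] to [t q^(-6)], up to [2 K + 1 + e] zeros in degree at
    most [2 K]. *)
Lemma Wsum_prim_eq0 (e : bool) w a K :
  (forall k (x := xk q (q ^+ e) k), (k < K)%N ->
    w k.+1 * ((1 - q ^+ 2 * x ^+ 2) * (1 - q ^+ 4 * x ^+ 2))
    = w k * ((1 - q * x ^+ 2) * (1 - q ^+ 3 * x ^+ 2) * (q ^+ 2 * x ^+ 2))) ->
  d = (4 * K + 2 * e + 1)%N \/ d = (4 * K + 2 * e + 3)%N ->
  Wsum q (q ^+ e) w a K = 0.
Proof.
move=> wS dE; pose x := xk q (q ^+ e) K.
have xE k : xk q (q ^+ e) k ^+ 2 = q ^+ (2 * e + 4 * k).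
  by rewrite /xk -exprD -exprM; congr (_ ^+ _); lia.
have tel t : Wsum q (q ^+ e) w (t * q ^+ 6) K * (t - x ^+ 3)
    * (if e then 1 - t * q ^+ 6 else q ^+ 3)
  = Wsum q (q ^+ e) w t K * (q ^+ K ^+ 6 * (1 - t * q ^+ 6 * x ^+ 3))
    * (if e then t - 1 else -1).
  have wSP k (X := xk q%:P (q ^+ e)%:P k) : (k < K)%N ->
      (w k.+1)%:P * ((1 - q%:P ^+ 2 * X ^+ 2) * (1 - q%:P ^+ 4 * X ^+ 2))
      = (w k)%:P * ((1 - q%:P * X ^+ 2) * (1 - q%:P ^+ 3 * X ^+ 2) * (q%:P ^+ 2 * X ^+ 2)).
    by move=> /wS wSk; rewrite /X xkC -!(polyC_exp, polyCM, polyCB, polyC1) wSk.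
  (* For [k < K] both exponents of [q] lie strictly between 0 and [d]. *)
  have vP k (X := xk q%:P (q ^+ e)%:P k) : (k < K)%N ->
      (1 - q%:P ^+ 2 * X ^+ 2) * (1 - q%:P ^+ 4 * X ^+ 2) != 0.
    move=> lt_kK; rewrite /X xkC -!(polyC_exp, polyCM, polyCB, polyC1) polyC_eq0 xE -!exprD.
    rewrite mulf_neq0 // subr_eq0 eq_sym expr_prim_neq1 // gtnNdvd //; lia.
  have y1q : ((q ^+ e)%:P == 1) || ((q ^+ e)%:P == q%:P).
    by case: (e); rewrite ?expr1 ?expr0 ?polyC1 eqxx ?orbT.
  have := telescope_Wsum y1q 'X wSP vP.
  (* One of the two factors is [1 - q^d]. *)
  have -> : (1 - q%:P * xk q%:P (q ^+ e)%:P K ^+ 2) * (1 - q%:P ^+ 3 * xk q%:P (q ^+ e)%:P K ^+ 2)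
     = 0.
    rewrite xkC -!(polyC_exp, polyCM, polyCB, polyC1) xE -exprS -exprD.
    case: dE => dE; last first.
      by rewrite (_ : (3 + (2 * e + 4 * K))%N = d) ?(prim_expr_order q_prim) ?subrr ?mulr0 //; lia.
    by rewrite (_ : (2 * e + 4 * K).+1%N = d) ?(prim_expr_order q_prim) ?subrr ?mul0r //; lia.
  rewrite !mulr0 mul0r mulr0 addr0 => telP.
  set W6 := Wsum _ _ _ ('X * _) _ in telP; set W1 := Wsum _ _ _ 'X _ in telP.
  (* The common factors at the lower end may vanish for particular values of [a], so they are
     cancelled as nonzero polynomials, before evaluation. *)
  pose g : {poly L} := if e then (1 - 'X * q%:P ^+ 2) * (1 - 'X * q%:P ^+ 4) * q%:P ^+ 3
    else (1 - 'X * q%:P) * (1 - 'X * q%:P ^+ 3) * (1 - 'X * q%:P ^+ 5).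
  have g0 : g != 0.
    apply/eqP => /(congr1 (fun p : {poly L} => p.[0])); rewrite /g -!polyC_exp.
    case: (e); rewrite !hornerE ?(mulr0, mul0r, subr0, mulr1, mul1r) => /eqP; last first.
      by rewrite oner_eq0.
    by rewrite /= mul1r !mulf_eq0 (negPf prim_root_neq0).
  have X3 : xk q%:P (q ^+ e)%:P K = x%:P by rewrite xkC.
  have {}telP : W6 * ('X - x%:P ^+ 3) * (if e then 1 - 'X * q%:P ^+ 6 else q%:P ^+ 3)
     = W1 * (q%:P ^+ K ^+ 6 * (1 - 'X * q%:P ^+ 6 * x%:P ^+ 3)) * (if e then 'X - 1 else -1).
    apply: (mulfI g0); move: telP; rewrite X3 /g.
    case: (e); rewrite ?expr1 ?expr0 => telP; last first.
      rewrite polyC1 in telP; rewrite mulrC.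
      transitivity (W6 * ((1 - 'X * q%:P * 1) * (1 - 'X * q%:P ^+ 3 * 1)
        * (1 - 'X * q%:P ^+ 5 * 1)) * (('X - x%:P ^+ 3) * q%:P ^+ 3)); first by ring.
      by rewrite telP; ring.
    transitivity (W6 * ((1 - 'X * q%:P * q%:P) * (1 - 'X * q%:P ^+ 3 * q%:P) *
     (1 - 'X * q%:P ^+ 5 * q%:P)) * (('X - x%:P ^+ 3) * q%:P ^+ 3)); first by ring.
    by rewrite telP; ring.
  move/(congr1 (fun p : {poly L} => p.[t])): telP.
  rewrite !hornerM /W6 /W1 !horner_Wsum -!polyC_exp.
  by case: (e); rewrite !hornerE /=.
(* [z] is the inverse of [q^6], so [r i = x^3 q^(-6 i)]. *)
pose z := q ^+ (6 * d.-1); pose r i := x ^+ 3 * z ^+ i.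
have zq : z * q ^+ 6 = 1.
  rewrite /z -exprD (_ : (6 * d.-1 + 6)%N = (d * 6)%N) ?exprM ?(prim_expr_order q_prim) ?expr1n //.
  by have := prim_order_gt0 q_prim; lia.
have rq i : r i.+1 * q ^+ 6 = r i by rewrite /r [z ^+ _]exprSr -!mulrA zq mulr1.
have rE i : r i * q ^+ (6 * i) = q ^+ (3 * e + 6 * K).
  rewrite /r -mulrA exprM -exprMn zq expr1n mulr1 /x /xk -exprD -exprM.
  by congr (_ ^+ _); lia.
have rW i : (i < 2 * K + 1 + e)%N -> Wsum q (q ^+ e) w (r i) K = 0.
  have K_neq0 : q ^+ K ^+ 6 != 0 by rewrite !expf_neq0 // prim_root_neq0.
  have e_neq0 j : (j < 2 * K + 1 + e)%N -> (if e then r j - 1 else -1) != 0.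
    case: ifP => [e1 lt_j|_ _]; last by rewrite oppr_eq0 oner_eq0.
    have eE : e = 1%N :> nat by rewrite e1.
    rewrite subr_eq0; apply/eqP => rj1; have := rE j; rewrite rj1 mul1r.
    (* Equality of the powers of [q^3] would equate the exponents [2 j] and [1 + 2 K], both below
       [d] and of opposite parity. *)
    have -> : (6 * j = 3 * (2 * j))%N by lia.
    have -> : (3 * e + 6 * K = 3 * (1 + 2 * K))%N by lia.
    by rewrite !(exprM q 3) => /(prim_expr_inj prim_root_expr_3); lia.
  have step j : (j < 2 * K + 1 + e)%N -> 1 - r j * q ^+ 6 * x ^+ 3 != 0 ->
      Wsum q (q ^+ e) w (r j * q ^+ 6) K * (r j - x ^+ 3) = 0 ->
      Wsum q (q ^+ e) w (r j) K = 0.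
    move=> lt_j r_neq1 W0.
    apply: (mulIf (mulf_neq0 (mulf_neq0 K_neq0 r_neq1) (e_neq0 j lt_j))).
    by rewrite mul0r mulrA -tel W0 mul0r.
  elim: i => [_|i IHi lt_i]; apply: step => //.
  - by lia.
  - rewrite subr_eq0; apply/eqP => /esym r1.
    have : (q ^+ 6) ^+ (e + 2 * K + 1) = (q ^+ 6) ^+ 0.
      rewrite expr0 -r1 /r expr0 mulr1 /x /xk -!exprD -!exprM -!exprD; congr (_ ^+ _); lia.
    by move/(prim_expr_inj prim_root_expr_6); lia.
  - by rewrite /r expr0 mulr1 subrr mulr0.
  - rewrite rq subr_eq0; apply/eqP => /esym r1.
    have : (q ^+ 6) ^+ (e + 2 * K) = (q ^+ 6) ^+ i.
      transitivity (r i * q ^+ (6 * i) * x ^+ 3); last by rewrite mulrAC r1 mul1r exprM.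
      rewrite rE /x /xk -!exprD -!exprM -!exprD.
      by congr (_ ^+ _); lia.
    by move/(prim_expr_inj prim_root_expr_6); lia.
  - by rewrite rq IHi ?mul0r //; lia.
have uniq_r : uniq [seq r i | i <- iota 0 (2 * K + 1 + e)].
  rewrite map_inj_in_uniq ?iota_uniq // => i j; rewrite !mem_iota => lt_i lt_j rij.
  have : (q ^+ 6) ^+ i = (q ^+ 6) ^+ j.
    rewrite -!exprM; apply: (mulfI (_ : r i != 0)); last by rewrite rE rij rE.
    apply: contraNneq (_ : q ^+ (3 * e + 6 * K) != 0) => [r0|].
      by rewrite -(rE i) r0 mul0r.
    by rewrite expf_neq0 // prim_root_neq0.
  by move/(prim_expr_inj prim_root_expr_6); lia.
have W0 : Wpoly q (q ^+ e) w K = 0.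
  apply: contraTeq isT => /max_poly_roots/(_ _ uniq_r) roots_lt.
  have := size_Wpoly q (q ^+ e) w K.
  suff /roots_lt : all (root (Wpoly q (q ^+ e) w K)) [seq r i | i <- iota 0 (2 * K + 1 + e)].
    rewrite size_map size_iota => lt_s le_s; exfalso; have := leq_trans lt_s le_s; lia.
  apply/allP => _ /mapP[i + ->]; rewrite mem_iota => lt_i.
  by rewrite /root horner_Wsum hornerX rW.
by have := horner_Wsum q (q ^+ e) w 'X a K; rewrite -/(Wpoly _ _ _ _) W0 !hornerE => <-.
Qed.

End PrimitiveRoot.

Lemma sum_triangle (V : nmodType) n (F : nat -> nat -> V) :
  \sum_(k < n) \sum_(j < k.+1) F j (k - j)%N
  = \sum_(i < n) \sum_(j < n | (i + j < n)%N) F i j.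
Proof.
transitivity (\sum_(k < n) \sum_(j < n | (j < k.+1)%N) F j (k - j)%N).
  by apply: eq_bigr => k _; rewrite (big_ord_widen _ (fun j => F j (k - j)%N) (ltn_ord k)).
rewrite (exchange_big_dep xpredT) //=; apply: eq_bigr => i _.
transitivity (\sum_(j < n - i) F i j); last first.
  rewrite (big_ord_widen _ (F i) (leq_subr i n)); apply: eq_bigl => j.
  by have := ltn_ord i; lia.
rewrite -(big_mkord (fun k => (i < k.+1)%N) (fun k => F i (k - i)%N)).
rewrite (big_cat_nat (n := i)) ?(ltnW (ltn_ord i)) //= big_nat_cond big_pred0 ?add0r; last first.
  by move=> k; lia.
rewrite -{1}[i : nat]add0n big_addn big_mkord; apply: eq_big => j; first by lia.
by rewrite addnK.
Qed.

(** * The double sum at a primitive root of unity *)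

Section RootOfUnity.
Variables (L : fieldType) (a q : L) (d : nat) (b : nat -> L).
Hypotheses (q_prim : d.-primitive_root q) (d_odd : odd d) (d_co3 : (d %% 3 != 0)%N).
Hypotheses (d_gt1 : (1 < d)%N) (a_neq0 : a != 0).
Hypothesis a_nonroot : forall m, (0 < m)%N -> a ^+ m != 1.
Hypothesis bS : forall m, b m.+1 * (1 - q ^+ (2 * m + 2)) = b m * (1 - q ^+ (2 * m + 1)).

(** At [m = s d + d./2] the factor [1 - q^(2m+1)] in [bS] is [1 - q^(d (2s+1)) = 0]; the zero value
    of [b] persists up to the next multiple of [d], as [1 - q^(2m+2)] is nonzero in between. *)
Lemma cterm_prim_eq0 j : (d./2 < (2 * j) %% d)%N -> cterm a q b j = 0.
Proof.
move=> lt_dj; suff b0 s r : (d./2 < r < d)%N -> b (s * d + r)%N = 0.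
  rewrite /cterm [(2 * j)%N](divn_eq _ d) b0 ?mulr0 ?mul0r //.
  by rewrite lt_dj ltn_pmod // ltnW.
elim: r => [|r IHr] //; rewrite ltnS => /andP[le_dr lt_rd].
have q2 : 1 - q ^+ (2 * (s * d + r) + 2) != 0.
  rewrite subr_eq0 eq_sym (expr_prim_neq1 q_prim) //.
  rewrite (_ : 2 * (s * d + r) + 2 = 2 * s * d + (2 * r + 2))%N; last by ring.
  rewrite dvdn_addr ?dvdn_mull //; apply/negP => /dvdnP[[|[|m]]]; [lia|lia|].
  by rewrite !mulSn; lia.
apply: (mulIf q2); rewrite mul0r addnS bS.
move: le_dr; rewrite leq_eqVlt => /orP[/eqP dr|lt_dr].
  rewrite (_ : 2 * (s * d + r) + 1 = d * (2 * s + 1))%N; last first.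
    by have := mulnC s d; lia.
  by rewrite exprM (prim_expr_order q_prim) expr1n subrr mulr0.
by rewrite IHr ?mul0r // lt_dr ltnW.
Qed.

(** A zero factor would make [a] or its inverse a power of [q], whereas [a^d] is not 1. *)
Lemma denk_prim_neq0 e K : denk q (q ^+ e) a K != 0.
Proof.
apply/prodf_neq0 => i _; rewrite /xk -exprD -exprM -mulrA -exprD.
set m := (_ + _)%N; have qm : (q ^+ m) ^+ d = 1.
  by rewrite -exprM mulnC exprM (prim_expr_order q_prim) expr1n.
have ad := a_nonroot (ltnW d_gt1).
rewrite mulf_neq0 // subr_eq0.
  by apply: contraNneq ad => aq; rewrite -[a ^+ d]mulr1 -{1}qm -exprMn -aq expr1n.
by apply: contraNneq ad => ->; rewrite qm.
Qed.

(* By [cterm_prim_eq0] only the first half of the run contributes: it starts at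
   [q ^ (2 j0) = q ^ odd s], and [denk] clears the denominators relative to [j0]. *)
Lemma half_block_eq0 t s :
  \sum_(j < d * t | ((2 * j) %/ d == s)%N) cterm a q b j = 0.
Proof.
case: (ltnP s (2 * t)) => [lt_st|le_ts]; last first.
  rewrite big_pred0 // => j; apply: contraTF le_ts => /eqP <-.
  rewrite -ltnNge (ltn_divLR _ _ (ltnW d_gt1)).
  by rewrite -mulnA ltn_mul2l /= [(t * d)%N]mulnC.
(* [j0] is the ceiling of [s d / 2], the first index of the run, and [K] is the last [k] with
   [e + 2 k <= d./2]. *)
pose e := odd s; pose j0 := (s * d + e)./2; pose K := ((d./2 - e)./2)%N.
have j0E : (2 * j0 = s * d + e)%N.
  rewrite /j0 mul2n halfK; suff -> : odd (s * d + e) = false by rewrite subn0.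
  by rewrite oddD oddM d_odd andbT oddb addbb.
pose G j := if ((2 * j) %/ d == s)%N then cterm a q b j else 0.
have d_ge5 : (5 <= d)%N by case: (d) d_odd d_co3 d_gt1 => [|[|[|[|[|]]]]].
have K1 : d = (4 * K + 2 * e + 1)%N \/ d = (4 * K + 2 * e + 3)%N by rewrite /K /e; lia.
rewrite big_mkcond -(big_mkord xpredT G).
have le_sd : (s.+1 * d <= 2 * (d * t))%N by rewrite mulnCA mulnC leq_mul2l lt_st orbT.
have le_jn : (j0 + K.+1 <= d * t)%N by rewrite mulSn in le_sd; lia.
rewrite (big_cat_nat (n := j0)) //=; last by lia.
rewrite [X in _ + X](big_cat_nat (n := (j0 + K.+1)%N)) ?leq_addr //=.
(* Terms outside [j0, ..., j0 + K] belong to another run or vanish by [cterm_prim_eq0]. *)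
have G0 m p : (forall j, (m <= j < p)%N -> (2 * j < s * d)%N \/ (s * d + d./2 < 2 * j)%N) ->
    \sum_(m <= j < p) G j = 0.
  move=> jP; rewrite big_nat_cond big1 // => j /andP[/jP j_out _]; rewrite /G.
  case: eqP => // js; have := divn_eq (2 * j) d; rewrite js => jE.
  have := ltn_pmod (2 * j) (ltnW d_gt1); move: jE; set r := (_ %% _)%N => jE lt_r.
  by apply: cterm_prim_eq0; rewrite -/r; case: j_out; lia.
rewrite G0 => [|j]; last by lia.
rewrite [X in _ + (_ + X)]G0 => [|j]; last by lia.
rewrite add0r addr0 -{1}[j0]add0n [(j0 + _)%N]addnC big_addn addnK big_mkord.
transitivity (\sum_(k < K.+1) cterm a q b (j0 + k)).
  apply: eq_bigr => k _; rewrite /G addnC.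
  have lt_kK := ltn_ord k.
  rewrite (_ : 2 * (j0 + k) = s * d + (e + 2 * k))%N ?divnMDl ?(ltnW d_gt1) //; last by lia.
  by rewrite divn_small ?addn0 ?eqxx //; lia.
have yE : q ^+ (2 * j0) = q ^+ e.
  by rewrite j0E exprD mulnC exprM (prim_expr_order q_prim) expr1n mul1r.
rewrite sum_cterm_block ?yE ?denk_prim_neq0 //; last first.
  by rewrite -[q]expr1 (expr_prim_neq1 q_prim) // dvdn1; lia.
have W0 : Wsum q (q ^+ e) (weight q b j0) a K = 0.
  apply: (Wsum_prim_eq0 q_prim) => // k x _.
  by have := weightS bS j0 k; rewrite yE.
by rewrite W0 mul0r mulr0.
Qed.

(** For fixed [i] with nonzero term, the surviving [j] with [i + j < d t] are those of all runs of
    number below [2 t - (2 i) %/ d], and each run sums to 0. *)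
Lemma sum_cterm_prim_eq0 t :
  \sum_(k < d * t) \sum_(j < k.+1) cterm a q b j * cterm a q b (k - j) = 0.
Proof.
rewrite (sum_triangle _ (fun i j => cterm a q b i * cterm a q b j)).
apply: big1 => i _; rewrite -mulr_sumr.
case: (leqP ((2 * i) %% d) d./2) => [i_small|/cterm_prim_eq0 ->]; last by rewrite mul0r.
suff S0 u : \sum_(j < d * t | ((2 * j) %/ d < u)%N) cterm a q b j = 0.
  rewrite -[RHS](mulr0 (cterm a q b i)) -[in RHS](S0 (2 * t - (2 * i) %/ d)%N); congr (_ * _).
  rewrite big_mkcond [RHS]big_mkcond; apply: eq_bigr => j _.
  case: (leqP ((2 * j) %% d) d./2) => [j_small|/cterm_prim_eq0 ->]; last by rewrite !if_same.
  congr (if _ then _ else _).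
  (* Both remainders are at most [d./2], so they add up to less than [d] and only the quotients
     decide whether [2 i + 2 j < 2 d t]. *)
  have := divn_eq (2 * i) d; have := divn_eq (2 * j) d.
  move: i_small j_small; set ri := (_ %% d)%N; set rj := (_ %% d)%N.
  set si := (_ %/ d)%N; set sj := (_ %/ d)%N => small_ri small_rj jE iE.
  have ndt : (d * t = t * d)%N by rewrite mulnC.
  apply/idP/idP => [lt_n|lt_s].
    rewrite ltnNge; apply/negP; rewrite leq_subLR => le_s.
    have : (2 * t * d <= (sj + si) * d)%N by rewrite leq_mul2r le_s orbT.
    by rewrite mulnDl -mulnA; lia.
  have : ((si + sj).+1 * d <= 2 * t * d)%N by rewrite leq_mul2r; apply/orP; right; lia.
  by rewrite mulSn mulnDl -mulnA; lia.
elim: u => [|u IHu]; first by rewrite big_pred0.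
rewrite (bigID (fun j : 'I_(d * t) => ((2 * j) %/ d == u)%N)) /=.
rewrite -[RHS](addr0 0); congr (_ + _).
  by rewrite -[RHS](half_block_eq0 t u); apply: eq_bigl => j; lia.
by rewrite -[RHS]IHu; apply: eq_bigl => j; lia.
Qed.
End RootOfUnity.

(** * Values at the roots of the modulus *)

(** The Gaussian binomial coefficient, given by Pascal's rule to avoid division: it makes sense at
    roots of unity and commutes with ring morphisms. *)
Fixpoint qbin (R : pzRingType) (q : R) n k : R := match n, k with
  | _, 0 => 1
  | 0, _.+1 => 0
  | n'.+1, k'.+1 => qbin q n' k' + q ^+ k'.+1 * qbin q n' k'.+1
  end.

Arguments qbin : simpl never.

Lemma qbin0 (R : pzRingType) (q : R) n : qbin q n 0 = 1.
Proof. by case: n. Qed.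

Lemma qbinS (R : pzRingType) (q : R) n k :
  qbin q n.+1 k.+1 = qbin q n k + q ^+ k.+1 * qbin q n k.+1.
Proof. by []. Qed.

Lemma qbin_small (R : pzRingType) (q : R) n k : (n < k)%N -> qbin q n k = 0.
Proof.
elim: n k => [|n IHn] [|k] //; rewrite ltnS => lt_nk.
by rewrite qbinS !IHn ?mulr0 ?addr0 // ltnW.
Qed.

Lemma rmorph_qbin (R S : pzRingType) (f : {rmorphism R -> S}) (q : R) n k :
  f (qbin q n k) = qbin (f q) n k.
Proof.
elim: n k => [|n IHn] [|k]; rewrite ?qbin0 ?rmorph1 ?rmorph0 //.
by rewrite !qbinS rmorphD rmorphM rmorphXn !IHn.
Qed.

(** Cross-multiplied, because [1 - q^(k+1)] may vanish at a root of unity. *)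
Lemma qbin_right (R : comNzRingType) (q : R) n k : (k <= n)%N ->
  (1 - q ^+ k.+1) * qbin q n k.+1 = (1 - q ^+ (n - k)) * qbin q n k.
Proof.
elim: n k => [|n IHn] k.
  by rewrite leqn0 => /eqP ->; rewrite qbin_small // expr0 subrr mulr0 mul0r.
rewrite leq_eqVlt => /orP[/eqP -> | lt_kn].
  by rewrite qbin_small // subnn expr0 subrr mulr0 mul0r.
rewrite qbinS mulrDr mulrCA; case: k lt_kn => [|k] lt_kn.
  by rewrite IHn // !qbin0 subn0 !subn0 (exprS q n) expr1; ring.
rewrite IHn // qbinS [RHS]mulrDr subSS -(IHn k); last by lia.
rewrite (_ : n - k = (n - k.+1).+1)%N; last by lia.
set B := qbin q n k.+1; set m := (n - k.+1)%N; rewrite !exprS; ring.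
Qed.

Lemma qbin_diag (R : comNzRingType) (q : R) n k : (k <= n)%N ->
  (1 - q ^+ k.+1) * qbin q n.+1 k.+1 = (1 - q ^+ n.+1) * qbin q n k.
Proof.
move=> le_kn; rewrite qbinS mulrDr mulrCA qbin_right // -[in q ^+ n.+1](subnKC le_kn).
by rewrite -addSn exprD; ring.
Qed.

(** Proved for an indeterminate, where [1 - 'X^(m+1)] can be cancelled, and then evaluated at
    [q]. *)
Lemma qbin_central (R : idomainType) (q : R) m :
  qbin q (2 * m).+1 m.+1 = qbin q (2 * m).+1 m.
Proof.
suff /(congr1 (horner_eval q)) : qbin 'X (2 * m).+1 m.+1 = qbin ('X : {poly R}) (2 * m).+1 m.
  by rewrite !rmorph_qbin /= [horner_eval q 'X]hornerX.
have X1 : (1 - 'X^(m.+1) : {poly R}) != 0.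
  rewrite subr_eq0 eq_sym; apply/eqP => /(congr1 (fun p : {poly R} => size p)).
  by rewrite size_polyXn size_poly1.
apply: (mulfI X1); rewrite qbin_right; last by lia.
by congr ((1 - _ ^+ _) * _); lia.
Qed.

(* The ratio of [(q; q^2)_m] and [(q^2; q^2)_m], in a form that is regular at roots of unity of
   odd order. *)
Definition bval (L : fieldType) (q : L) m :=
  qbin q (2 * m) m / (\prod_(i < m) (1 + q ^+ i.+1)) ^+ 2.

Lemma bval0 (L : fieldType) (q : L) : bval q 0 = 1.
Proof. by rewrite /bval big_ord0 expr1n divr1. Qed.

(** Pascal's rule and [qbin_central] give the central coefficient of row [2 m + 2] as [1 + q^(m+1)]
    times one of row [2 m + 1], which [qbin_diag] links to row [2 m]. *)
Lemma bvalS (L : fieldType) (q : L) m : (forall i, 1 + q ^+ i.+1 != 0) ->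
  bval q m.+1 * (1 - q ^+ (2 * m + 2)) = bval q m * (1 - q ^+ (2 * m + 1)).
Proof.
move=> q1; rewrite /bval big_ord_recr /= (_ : 2 * m.+1 = (2 * m).+2)%N; last by lia.
have P0 : \prod_(i < m) (1 + q ^+ i.+1) != 0 by apply/prodf_neq0 => i _.
rewrite qbinS -qbin_central -[X in X + _]mul1r -mulrDl.
have -> : 1 - q ^+ (2 * m + 2) = (1 + q ^+ m.+1) * (1 - q ^+ m.+1).
  by rewrite (_ : 2 * m + 2 = m.+1 * 2)%N ?exprM; [ring|lia].
have := @qbin_diag _ q (2 * m) m; rewrite addn1 => dg.
set P := \prod_(i < m) _ in P0 *; set B := qbin q _ m.+1 in dg *.
transitivity ((1 - q ^+ m.+1) * B / P ^+ 2); first by field; rewrite P0 q1.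
by rewrite dg; [field | lia].
Qed.

Lemma c_q_cterm (L : fieldType) (a q : L) k :
  (forall i, 1 + q ^+ i.+1 != 0) -> (forall m, (0 < m)%N -> q ^+ m != 1) ->
  c_q a q k = cterm a q (bval q) k.
Proof.
move=> q1 qn; suff bE m : bval q m = qpoch q (q ^+ 2) m / qpoch (q ^+ 2) (q ^+ 2) m.
  by rewrite /c_q /cterm bE !invfM; ring.
elim: m => [|m IHm]; first by rewrite bval0 /qpoch !big_ord0 divr1.
have qm : 1 - q ^+ (2 * m + 2) != 0 by rewrite subr_eq0 eq_sym qn // addn2.
apply: (mulIf qm); rewrite bvalS // IHm /qpoch !big_ord_recr /=.
rewrite -/(qpoch q (q ^+ 2) m) -/(qpoch (q ^+ 2) (q ^+ 2) m).
have -> : q * (q ^+ 2) ^+ m = q ^+ (2 * m + 1) by rewrite -exprM -exprS addn1.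
have -> : q ^+ 2 * (q ^+ 2) ^+ m = q ^+ (2 * m + 2) by rewrite -exprM -exprD addnC.
by rewrite invfM mulrA mulfVK // mulrAC.
Qed.

(** Lets the roots with [r^n = a] be treated as those with [a = r^(-n)]. *)
Lemma cterm_inv (L : fieldType) (a q : L) b k : cterm a^-1 q b k = cterm a q b k.
Proof.
by rewrite /cterm !invrK; congr (_ / _ * _ * _ * _); rewrite mulrC ![a^-1 * _]mulrC ![a * _]mulrC.
Qed.

(** * The double sum at a root of the modulus *)

Section Roots.
Variables (L : fieldType) (a r : L) (n : nat).
Hypotheses (n_gt0 : (0 < n)%N) (n_co6 : coprime n 6).
Hypotheses (a_neq0 : a != 0) (a_nonroot : forall m, (0 < m)%N -> a ^+ m != 1).
Hypothesis two_neq0 : (2%:R : L) != 0.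
Hypothesis r_root : [\/ r ^+ n = 1 /\ r != 1, a * r ^+ n = 1 | r ^+ n = a].

Lemma coprime6P : odd n /\ (n %% 3 != 0)%N.
Proof.
move: n_co6; rewrite (_ : 6 = 2 * 3)%N // coprimeMr coprimen2 => /andP[-> ].
by rewrite coprime_sym prime_coprime.
Qed.

Lemma a_expr_inj i j : a ^+ i = a ^+ j -> i = j.
Proof. exact: expr_nonroot_inj. Qed.

Lemma root_neq0 : r != 0.
Proof.
apply/eqP => r0; case: r_root; rewrite r0 expr0n eqn0Ngt n_gt0 /=.
- by case=> /eqP; rewrite eq_sym oner_eq0.
- by rewrite mulr0 => /eqP; rewrite eq_sym oner_eq0.
- by move=> a0; case/eqP: a_neq0.
Qed.

(** In the two other cases [r^n] is [a] or its inverse, and [a] is not a root of unity. *)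
Lemma root_expr m : r ^+ m = 1 -> (0 < m)%N -> r ^+ n = 1.
Proof.
move=> rm m_gt0; have am : a ^+ m != 1 by apply: a_nonroot.
have rnm : (r ^+ n) ^+ m = 1 by rewrite -exprM mulnC exprM rm expr1n.
case: r_root => [[] //|arn|rn].
  by case/eqP: am; rewrite -[a ^+ m]mulr1 -{1}rnm -exprMn arn expr1n.
by case/eqP: am; rewrite -rn.
Qed.

(** If [r^(i+1) = -1], then [r] is a root of unity and [r^n = 1]; raising to the odd power [n] gives
    [1 = -1]. *)
Lemma root_opp i : 1 + r ^+ i.+1 != 0.
Proof.
rewrite addrC addr_eq0; apply/eqP => ri.
have rn : r ^+ n = 1 by apply: (@root_expr (i.+1 * 2)); rewrite ?exprM ?ri ?sqrrN ?expr1n ?muln2.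
have := congr1 (fun x => x ^+ n) ri.
rewrite -exprM mulnC exprM rn expr1n -signr_odd (proj1 coprime6P) expr1 => /eqP.
by rewrite -subr_eq0 opprK -mulr2n (negPf two_neq0).
Qed.

(** The [n]-th power of an equality would make a positive power of [a] equal to 1, or equate the odd
    [n] with [6 + 6 m]. *)
Lemma root_den m : a * r ^+ (6 + 6 * m) != 1.
Proof.
have [n_odd _] := coprime6P; apply/eqP => /(congr1 (fun x => x ^+ n)).
rewrite exprMn -exprM mulnC exprM expr1n.
case: r_root => [[-> _]|arn|->].
- by rewrite expr1n mulr1; apply/eqP/a_nonroot.
- move/(congr1 (fun x => a ^+ (6 + 6 * m) * x)); rewrite mulrCA -exprMn arn expr1n !mulr1.
  by move/a_expr_inj; lia.
by rewrite -exprD; apply/eqP/a_nonroot; lia.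
Qed.

Lemma root_den_inv m : r ^+ (6 + 6 * m) != a.
Proof.
have [n_odd _] := coprime6P; apply/eqP => /(congr1 (fun x => x ^+ n)).
rewrite -exprM mulnC exprM.
case: r_root => [[-> _]|arn|->].
- by rewrite expr1n => /esym; apply/eqP/a_nonroot.
- move/(congr1 (fun x => a ^+ (6 + 6 * m) * x)); rewrite -exprMn arn expr1n -exprD => /esym.
  by apply/eqP/a_nonroot; lia.
by move/a_expr_inj; lia.
Qed.

Let c := cterm a r (bval r).

Lemma sum_root_eq0 :
  \sum_(k < n) \sum_(j < k.+1) c j * c (k - j)%N - r ^- (n - 1) * qint r n ^+ 2 = 0.
Proof.
have [n_odd n_co3] := coprime6P.
have bS m := bvalS m root_opp.
(* Serves both families where [r] is not a root of unity, with [A = a] or [A = a^-1]. *)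
have generic A : r ^+ n != 1 -> A = r ^- n -> c =1 cterm A r (bval r) ->
    \sum_(k < n) \sum_(j < k.+1) c j * c (k - j)%N = r ^- (n - 1) * qint r n ^+ 2.
  move=> rn1 AE cE; have r_nonroot m : (0 < m)%N -> r ^+ m != 1.
    by move=> m_gt0; apply: contra_neq rn1 => /root_expr ->.
  rewrite -(sum_cterm_sqr root_neq0 r_nonroot (bval0 r) bS n_odd n_co3) -AE.
  have c0 k : (n <= 2 * k)%N -> c k = 0.
    by move=> le_nk; rewrite cE AE cterm_eq0 // root_neq0.
  rewrite (sum_triangle _ (fun i j => c i * c j)).
  transitivity ((\sum_(i < n) c i) ^+ 2).
    rewrite expr2 mulr_suml; apply: eq_bigr => i _; rewrite mulr_sumr big_mkcond.
    apply: eq_bigr => j _; case: ltnP => // le_n.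
    (* The pairs excluded by [i + j < n] contribute nothing, which makes the double sum a square. *)
    have [|] : (n <= 2 * i)%N \/ (n <= 2 * j)%N by lia.
      by move/c0->; rewrite mul0r.
    by move/c0->; rewrite mulr0.
  congr (_ ^+ 2).
  rewrite (eq_bigr (fun i : 'I_n => cterm A r (bval r) i)) => [|i _]; last exact: cE.
  have le_n : ((n./2).+1 <= n)%N by lia.
  rewrite (big_ord_widen _ (cterm A r (bval r)) le_n) [RHS]big_mkcond.
  by apply: eq_bigr => i _; case: ltnP => // le_i; rewrite -cE c0 //; lia.
case: r_root => [[rn r1]|arn|rn].
- have qn0 : qint r n = 0 by rewrite qintE // rn subrr mul0r.
  rewrite qn0 expr0n mulr0 subr0.
  have [d d_prim /dvdnP[t nE]] := prim_order_exists n_gt0 rn.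
  have d_odd : odd d by move: n_odd; rewrite nE oddM => /andP[].
  have d_co3 : (d %% 3 != 0)%N.
    by apply: contra n_co3 => /eqP d3; rewrite nE -modnMm d3 muln0.
  have d_gt1 : (1 < d)%N.
    rewrite ltn_neqAle (prim_order_gt0 d_prim) andbT; apply: contra_neq r1 => d1.
    by rewrite -[r]expr1 d1 (prim_expr_order d_prim).
  by rewrite nE mulnC (sum_cterm_prim_eq0 d_prim).
- rewrite (generic a) ?subrr //.
  + apply/eqP => rn; move: arn; rewrite rn mulr1 => /eqP.
    by rewrite -[a]expr1; apply/negP/a_nonroot.
  + by apply: (mulIf (expf_neq0 n root_neq0)); rewrite arn mulVf // expf_neq0 // root_neq0.
rewrite (generic a^-1) ?subrr //; last by move=> k; rewrite cterm_inv.
  by rewrite rn -[a]expr1 a_nonroot.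
by rewrite rn.
Qed.
End Roots.

(** * Specialization of fractions *)

(* An alias, because [countable_algebraic_closure] needs a countable structure on [Q(a)]. *)
Definition fracZ := {fraction {poly int}}.
HB.instance Definition _ := GRing.Field.copy fracZ {fraction {poly int}}.

Definition fracZ_code (x : fracZ) : {poly int} * {poly int} :=
  frac (generic_quotient.repr x).
Definition fracZ_decode (p : {poly int} * {poly int}) : fracZ :=
  generic_quotient.pi fracZ (Ratio p.1 p.2).

Lemma fracZ_codeK : cancel fracZ_code fracZ_decode.
Proof.
move=> x; rewrite /fracZ_decode /fracZ_code FracField.Ratio_numden.
exact: generic_quotient.reprK.
Qed.

HB.instance Definition _ := CanIsCountable fracZ_codeK.

Lemma poly_int_closed_ext :
  exists (L : closedFieldType) (iota : {rmorphism {poly int} -> L}), injective iota.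
Proof.
have [K [f _]] := countable_algebraic_closure fracZ.
pose f' : {rmorphism {fraction {poly int}} -> K} := f.
exists K, (f' \o @FracField.tofrac {poly int}) => x y /= /fmorph_inj/eqP.
by rewrite tofrac_eq => /eqP.
Qed.

Lemma rmorph_qint (R S : pzRingType) (f : {rmorphism R -> S}) (q : R) m :
  f (qint q m) = qint (f q) m.
Proof. by rewrite /qint rmorph_sum; apply: eq_bigr => i _; rewrite rmorphXn. Qed.

Section Specialization.
Variables (R : idomainType) (L : fieldType) (D : L -> Prop) (sigma : L -> {rmorphism R -> L}).
Variable (r0 : L).
Hypothesis Dr0 : D r0.

(* [x] is regular on [D] and takes there the values [v]; one representative must serve all
   the points of [D] at once. *)
Definition spec (x : {fraction R}) (v : L -> L) := exists A B : R,
  x = FracField.tofrac A / FracField.tofrac B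
  /\ forall r, D r -> sigma r B != 0 /\ sigma r A = v r * sigma r B.

Lemma spec_neq0 B : (forall r, D r -> sigma r B != 0) -> FracField.tofrac B != 0.
Proof. by move=> /(_ _ Dr0); rewrite tofrac_eq0; apply: contraNneq => ->; rewrite rmorph0. Qed.

Lemma spec_ext x v v' : (forall r, D r -> v r = v' r) -> spec x v -> spec x v'.
Proof.
by move=> vE [A [B [xE sAB]]]; exists A, B; split=> // r Dr; rewrite -vE //; apply: sAB.
Qed.

Lemma spec_tofrac A : spec (FracField.tofrac A) (fun r => sigma r A).
Proof.
exists A, 1; split=> [|r _]; first by rewrite rmorph1 divr1.
by rewrite rmorph1 oner_neq0 mulr1.
Qed.

Lemma spec_add x y v w : spec x v -> spec y w -> spec (x + y) (fun r => v r + w r).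
Proof.
move=> [A [B [xE sAB]]] [A' [B' [yE sAB']]]; exists (A * B' + A' * B), (B * B'); split=> [|r Dr].
  have B0 : FracField.tofrac B != 0 by apply: spec_neq0 => r /sAB[].
  have B'0 : FracField.tofrac B' != 0 by apply: spec_neq0 => r /sAB'[].
  by rewrite xE yE rmorphD !rmorphM addf_div.
have [B0 AE] := sAB r Dr; have [B'0 A'E] := sAB' r Dr.
by rewrite rmorphD !rmorphM AE A'E mulf_neq0 //; split=> //; ring.
Qed.

Lemma spec_mul x y v w : spec x v -> spec y w -> spec (x * y) (fun r => v r * w r).
Proof.
move=> [A [B [xE sAB]]] [A' [B' [yE sAB']]]; exists (A * A'), (B * B'); split=> [|r Dr].
  by rewrite xE yE !rmorphM mulf_div.
have [B0 AE] := sAB r Dr; have [B'0 A'E] := sAB' r Dr.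
by rewrite !rmorphM AE A'E mulf_neq0 //; split=> //; ring.
Qed.

Lemma spec_inv x v : (forall r, D r -> v r != 0) -> spec x v -> spec x^-1 (fun r => (v r)^-1).
Proof.
move=> v0 [A [B [xE sAB]]]; exists B, A; split=> [|r Dr]; first by rewrite xE invf_div.
have [B0 AE] := sAB r Dr; rewrite AE mulf_neq0 ?v0 //; split=> //.
by rewrite mulKf ?v0.
Qed.

Lemma spec_div x y v w : (forall r, D r -> w r != 0) ->
  spec x v -> spec y w -> spec (x / y) (fun r => v r / w r).
Proof. by move=> w0 sx sy; apply: spec_mul => //; apply: spec_inv. Qed.

Lemma spec_1 : spec 1 (fun=> 1).
Proof.
rewrite -(rmorph1 (@FracField.tofrac R)).
by apply: spec_ext (spec_tofrac 1) => r _; rewrite rmorph1.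
Qed.

Lemma spec_opp x v : spec x v -> spec (- x) (fun r => - v r).
Proof.
move=> sx; rewrite -mulN1r -(rmorphN1 (@FracField.tofrac R)).
apply: spec_ext (spec_mul (spec_tofrac (-1)) sx) => r _.
by rewrite rmorphN1 mulN1r.
Qed.

Lemma spec_exp x v m : spec x v -> spec (x ^+ m) (fun r => v r ^+ m).
Proof.
move=> sx; elim: m => [|m IHm]; first exact: spec_1.
rewrite exprS; apply: spec_ext (spec_mul sx IHm) => r _.
by rewrite exprS.
Qed.

Lemma spec_sum I (s : seq I) F V : (forall i, spec (F i) (V i)) ->
  spec (\sum_(i <- s) F i) (fun r => \sum_(i <- s) V i r).
Proof.
move=> sF; elim: s => [|i s IHs].
  rewrite big_nil -(rmorph0 (@FracField.tofrac R)).
  by apply: spec_ext (spec_tofrac 0) => r _; rewrite rmorph0 big_nil.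
by rewrite big_cons; apply: spec_ext (spec_add (sF i) IHs) => r _; rewrite big_cons.
Qed.

Lemma spec_prod I (s : seq I) F V : (forall i, spec (F i) (V i)) ->
  spec (\prod_(i <- s) F i) (fun r => \prod_(i <- s) V i r).
Proof.
move=> sF; elim: s => [|i s IHs].
  by rewrite big_nil; apply: spec_ext spec_1 => r _; rewrite big_nil.
by rewrite big_cons; apply: spec_ext (spec_mul (sF i) IHs) => r _; rewrite big_cons.
Qed.

Lemma spec_qpoch x y v w m : spec x v -> spec y w ->
  spec (qpoch x y m) (fun r => qpoch (v r) (w r) m).
Proof.
move=> sx sy; apply: spec_prod => i.
by apply: spec_add spec_1 (spec_opp (spec_mul sx (spec_exp i sy))).
Qed.

End Specialization.

(** * The modulus and the congruence *)

Definition modulus n : Zaq :=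
  qint q_var n * (1 - a_var * q_var ^+ n) * (a_var - q_var ^+ n).

Lemma XnsubC_uniq_roots (L : closedFieldType) n (c : L) :
  n%:R != 0 :> L -> c != 0 ->
  exists2 rs, uniq rs & 'X^n - c%:P = \prod_(z <- rs) ('X - z%:P).
Proof.
move=> n0 c0; have n_gt0 : (0 < n)%N by case: n n0 => //; rewrite eqxx.
have [rs pE] := closed_field_poly_normal ('X^n - c%:P).
rewrite (monicP (monicXnsubC c n_gt0)) scale1r in pE.
exists rs => //; rewrite -separable_prod_XsubC -pE separable_poly.unlock.
(* The combination of ['X^n - c] and its derivative is the nonzero constant [n c]. *)
apply/Bezout_coprimepP; exists (- n%:R%:P, 'X) => /=.
rewrite derivB derivXn derivC subr0.
have -> : - n%:R%:P * ('X^n - c%:P) + 'X * ('X^(n.-1) *+ n) = (n%:R * c)%:P :> {poly L}.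
  by rewrite mulrnAr -exprS prednK // polyCM -[X in _ + X]mulr_natl polyC_natr; ring.
by rewrite polyC_eqp1 mulf_neq0.
Qed.

(* The modulus is primitive as a polynomial over [Z[a]]: its value at [q = 0] is [a], so a
   constant divisor divides [a], and at [a = 0] one of its coefficients is [-1]. *)
Lemma modulus_dvd_const n (delta : {poly int}) (e : Zaq) : (0 < n)%N ->
  modulus n = delta%:P * e -> exists u : {poly int}, delta * u = 1.
Proof.
move=> n_gt0 PE.
have n0 : (n == 0)%N = false by case: n n_gt0 {PE}.
have XE : 'X = delta * e.[0].
  pose ev : {rmorphism Zaq -> {poly int}} := horner_eval 0.
  have evC c : ev c%:P = c by apply: hornerC.
  have evX : ev 'X = 0 by apply: hornerX.
  have := congr1 ev PE; rewrite /modulus !rmorphM !rmorphB !rmorphM !rmorphXn rmorph1.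
  rewrite rmorph_qint /a_var /q_var evX !evC expr0n n0 mulr0 !subr0 mulr1 => <-.
  rewrite -[n]prednK // /qint big_ord_recl expr0 big1 ?addr0 ?mul1r // => i _.
  by rewrite expr0n.
have d0 : exists k, delta.[0] * k = -1.
  pose ev : {rmorphism {poly int} -> int} := horner_eval 0.
  pose phi : {rmorphism Zaq -> {poly int}} := map_poly ev.
  have phiC c : phi c%:P = (c.[0])%:P by apply: map_polyC.
  have phiX : phi 'X = 'X by apply: map_polyX.
  exists ((phi e)`_n); have := congr1 (fun p : {poly int} => p`_n) (congr1 phi PE).
  rewrite [phi (_ * e)]rmorphM phiC coefCM => <-.
  rewrite /modulus !rmorphM !rmorphB !rmorphM !rmorphXn rmorph1 rmorph_qint /a_var /q_var.
  rewrite phiC phiX hornerX polyC0 mul0r subr0 sub0r mulrN.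
  rewrite coefN mulr1 coefMXn ltnn subnn -[n]prednK // /qint big_ord_recl expr0.
  rewrite coefD coef1 /= coef_sum big1 ?addr0 // => i _.
  by rewrite coefXn.
have [k dk] := d0.
(* In ['X = delta * e.[0]] one factor is constant. If it were [e.[0]], evaluation at 0 would make it
   zero, as [delta.[0]] is nonzero. *)
have sz : (size delta <= 1)%N.
  have delta0 : delta != 0 by apply/eqP => d0'; move: dk; rewrite d0' hornerC mul0r.
  have e0 : e.[0] != 0.
    by apply/eqP => e0'; move/eqP: XE; rewrite e0' mulr0 polyX_eq0.
  have := congr1 (fun p : {poly int} => size p) XE; rewrite size_polyX size_mul //.
  case: (ltnP 1 (size delta)) => // d_gt1; case: (ltnP 1 (size e.[0])) => [e_gt1|e_le1 _].
    by move=> sz2; have := leq_add d_gt1 e_gt1; case: (_ + _)%N sz2 => [|[|[|[]]]].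
  have := congr1 (horner_eval 0) XE; rewrite {1}/horner_eval hornerX rmorphM /= (size1_polyC e_le1).
  rewrite /horner_eval hornerC => /esym/eqP; rewrite mulf_eq0 => /orP[/eqP d0'|/eqP e0'].
    by move: dk; rewrite d0' mul0r.
  by move: e0; rewrite (size1_polyC e_le1) e0' polyC0 eqxx.
by exists (- k)%:P; rewrite (size1_polyC sz) -polyCM -horner_coef0 mulrN dk opprK polyC1.
Qed.

Section Assembly.
Variables (L : closedFieldType) (iota : {rmorphism {poly int} -> L}).
Hypothesis iota_inj : injective iota.
Variable (n : nat).
Hypotheses (n_gt0 : (0 < n)%N) (n_co6 : coprime n 6).

Let alpha := iota 'X.

Definition eval_q (r : L) : {rmorphism Zaq -> L} := horner_eval r \o map_poly iota.

Lemma eval_q_a r : eval_q r a_var = alpha.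
Proof. by rewrite /eval_q /= /horner_eval /a_var map_polyC hornerC. Qed.

Lemma eval_q_q r : eval_q r q_var = r.
Proof. by rewrite /eval_q /= /horner_eval /q_var map_polyX hornerX. Qed.

Lemma iota_eq0 x : (iota x == 0) = (x == 0).
Proof. by rewrite -(rmorph0 iota) (inj_eq iota_inj). Qed.

Lemma alpha_neq0 : alpha != 0.
Proof. by rewrite iota_eq0 polyX_eq0. Qed.

Lemma alpha_nonroot m : (0 < m)%N -> alpha ^+ m != 1.
Proof.
move=> m_gt0; rewrite -rmorphXn -subr_eq0 -(rmorph1 iota) -rmorphB iota_eq0 subr_eq0.
apply/eqP => /(congr1 (fun p : {poly int} => size p)).
by rewrite size_polyXn size_poly1; case: m m_gt0.
Qed.

Lemma natr_closed_neq0 m : (0 < m)%N -> (m%:R : L) != 0.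
Proof.
move=> m_gt0; rewrite -(rmorph_nat iota) iota_eq0 -polyC_natr polyC_eq0.
by rewrite Num.Theory.pnatr_eq0 -lt0n.
Qed.

Lemma eval_modulus r : eval_q r (modulus n) = qint r n * (1 - alpha * r ^+ n) * (alpha - r ^+ n).
Proof.
by rewrite /modulus !rmorphM !rmorphB rmorph1 !rmorphM !rmorphXn rmorph_qint eval_q_a eval_q_q.
Qed.

Lemma modulus_rootP r : eval_q r (modulus n) = 0 ->
  [\/ r ^+ n = 1 /\ r != 1, alpha * r ^+ n = 1 | r ^+ n = alpha].
Proof.
move/eqP; rewrite eval_modulus !mulf_eq0 -orbA => /or3P[/eqP q0|/eqP a1|/eqP a2].
- apply: Or31; have r1 : r != 1.
    apply/eqP => r1; have /eqP[] := natr_closed_neq0 n_gt0; rewrite -q0 r1 /qint.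
    by rewrite (eq_bigr (fun=> 1)) ?sumr_const ?card_ord // => i _; rewrite expr1n.
  by split=> //; apply/eqP; rewrite -subr_eq0 subrX1 -/(qint r n) q0 mulr0.
- by apply: Or32; apply/esym/subr0_eq.
- by apply: Or33; apply/esym/subr0_eq.
Qed.

Definition iroot r := eval_q r (modulus n) = 0.

Lemma iroot_ex : exists r, iroot r.
Proof.
have [r rE] := solve_monicpoly (fun i => if i == 0%N then alpha else 0) n_gt0.
exists r; rewrite /iroot eval_modulus; suff -> : r ^+ n = alpha by rewrite subrr mulr0.
rewrite rE -[n]prednK // big_ord_recl /= mulr1 big1 ?addr0 // => i _.
by rewrite mul0r.
Qed.

Lemma map_modulus : map_poly iota (modulus n)
  = qint 'X n * (1 - alpha%:P * 'X^n) * (alpha%:P - 'X^n).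
Proof.
rewrite /modulus !rmorphM !rmorphB rmorph1 !rmorphM !rmorphXn rmorph_qint /=.
by rewrite /a_var /q_var map_polyC map_polyX.
Qed.

(** Times ['X - 1], the modulus is [alpha] times the product of ['X^n - c] for [c] equal to [1],
    [alpha^-1], [alpha]. These are distinct, so all the roots are simple. *)
Lemma modulus_dvd (A : Zaq) : (forall r, iroot r -> eval_q r A = 0) ->
  map_poly iota (modulus n) %| map_poly iota A.
Proof.
move=> A0; have nn0 := natr_closed_neq0 n_gt0; have a0 := alpha_neq0.
have [rs1 u1 E1] := XnsubC_uniq_roots nn0 (oner_neq0 L).
have [rs2 u2 E2] := XnsubC_uniq_roots nn0 (invr_neq0 a0).
have [rs3 u3 E3] := XnsubC_uniq_roots nn0 a0.
have PE : ('X - 1%:P) * map_poly iota (modulus n)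
    = alpha%:P * \prod_(z <- rs1 ++ rs2 ++ rs3) ('X - z%:P).
  have q1 : ('X - 1%:P) * qint 'X n = 'X^n - 1 :> {poly L} by rewrite polyC1 /qint -subrX1.
  rewrite map_modulus !big_cat /= -E1 -E2 -E3 -[qint _ _ * _ * _]mulrA.
  rewrite [LHS]mulrA q1 polyC1.
  have aV : alpha%:P * (alpha^-1)%:P = 1 :> {poly L} by rewrite -polyCM mulfV // polyC1.
  transitivity (('X^n - 1) * ((alpha%:P * (alpha^-1)%:P - alpha%:P * 'X^n) * (alpha%:P - 'X^n))).
    by rewrite aV.
  by ring.
have root_rs (c z : L) rs : 'X^n - c%:P = \prod_(z <- rs) ('X - z%:P) -> z \in rs -> z ^+ n = c.
  move=> E z_rs; apply/eqP; rewrite -subr_eq0.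
  have : root ('X^n - c%:P) z by rewrite E root_prod_XsubC.
  by rewrite /root !hornerE.
have a2 : alpha ^+ 2 != 1 by apply: alpha_nonroot.
have a1 : alpha != 1 by rewrite -[alpha]expr1 alpha_nonroot.
have urs : uniq (rs1 ++ rs2 ++ rs3).
  rewrite !cat_uniq u1 u2 u3 /= andbT has_cat negb_or; apply/andP; split; [apply/andP; split|].
  - apply/hasPn => z /(root_rs _ _ _ E2) z2; apply: contra a1 => /(root_rs _ _ _ E1) z1.
    by rewrite -invr_eq1 -z2 z1.
  - apply/hasPn => z /(root_rs _ _ _ E3) z3.
    by apply: contra a1 => /(root_rs _ _ _ E1) <-; rewrite z3.
  - apply/hasPn => z /(root_rs _ _ _ E3) z3; apply: contra a2 => /(root_rs _ _ _ E2) z2.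
    by rewrite expr2 -{1}z3 z2 mulVf.
have X1 : ('X - 1%:P : {poly L}) != 0 by rewrite polyXsubC_eq0.
rewrite -(dvdp_mul2l _ _ X1) PE mul_polyC dvdpZl //.
apply: uniq_roots_dvdp; last by rewrite uniq_rootsE.
apply/allP => z z_rs; have : root (('X - 1%:P) * map_poly iota (modulus n)) z.
  by rewrite PE rootM root_prod_XsubC z_rs orbT.
rewrite !rootM => /orP[-> //|/eqP Pz]; apply/orP; right; apply/eqP.
exact: A0.
Qed.

Lemma size_map_iota (p : Zaq) : size (map_poly iota p) = size p.
Proof. by rewrite size_map_inj_poly ?rmorph0. Qed.

(** Pseudo-division over [Z[a]]: the image of the remainder is a multiple of that of [P] and of
    smaller degree, hence zero, and [c] is the power of the leading coefficient introduced. *)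
Lemma dvd_clear_denom (P A : Zaq) : P != 0 -> map_poly iota P %| map_poly iota A ->
  exists c : {poly int}, c != 0 /\ dvdR P (c%:P * A).
Proof.
move=> P0 PA; exists (lead_coef P ^+ scalp A P); split.
  by rewrite expf_neq0 // lead_coef_eq0.
exists (A %/ P); rewrite mul_polyC Pdiv.Idomain.divp_eq [P * _]mulrC.
suff -> : A %% P = 0 by rewrite addr0.
apply/eqP; rewrite -size_poly_eq0 -size_map_iota size_poly_eq0.
have lt_mod : (size (A %% P)%R < size P)%N by rewrite ltn_modp.
apply: contraTT lt_mod => mod0; rewrite -leqNgt.
rewrite -[size P]size_map_iota -[size (_ %% _)%R]size_map_iota; apply: dvdp_leq => //.
have /(congr1 (map_poly iota)) := Pdiv.Idomain.divp_eq A P.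
rewrite -!mul_polyC rmorphD !rmorphM /= => /esym/(canRL (addKr _)) ->.
by rewrite dvdp_addr ?dvdp_mull // dvdpNr dvdp_mull.
Qed.

Let a : {fraction Zaq} := FracField.tofrac a_var.
Let q : {fraction Zaq} := FracField.tofrac q_var.

Lemma q_frac_nonroot m : (0 < m)%N -> q ^+ m != 1.
Proof.
move=> m_gt0; rewrite -rmorphXn -(rmorph1 (@FracField.tofrac Zaq)) tofrac_eq.
apply/eqP => /(congr1 (fun p : Zaq => size p)); rewrite /q_var size_polyXn size_poly1.
by case: m m_gt0.
Qed.

Lemma q_frac_opp m : 1 + q ^+ m.+1 != 0.
Proof.
rewrite -rmorphXn -(rmorph1 (@FracField.tofrac Zaq)) -rmorphD tofrac_eq0.
pose ev : {rmorphism Zaq -> {poly int}} := horner_eval 0.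
have evX : ev q_var = 0 by apply: hornerX.
apply/eqP => /(congr1 ev); rewrite rmorphD rmorph1 rmorphXn evX expr0n addr0 rmorph0.
by move/eqP; rewrite oner_eq0.
Qed.

Let spc := @spec Zaq L iroot eval_q.

(** By [root_opp], [root_den] and [root_den_inv], none of the denominators vanishes at a root of the
    modulus. *)
Lemma spec_cterm k :
  spc (cterm a q (bval q) k) (fun r => cterm alpha r (bval r) k).
Proof.
have [r0 Dr0] := iroot_ex; have a0 := alpha_neq0.
have two0 : (2%:R : L) != 0 by apply: natr_closed_neq0.
have D_opp r (Dr : iroot r) := root_opp n_co6 alpha_nonroot two0 (modulus_rootP Dr).
have D_den r (Dr : iroot r) :=
  root_den n_gt0 n_co6 a0 alpha_nonroot two0 (modulus_rootP Dr).
have D_inv r (Dr : iroot r) :=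
  root_den_inv n_gt0 n_co6 a0 alpha_nonroot two0 (modulus_rootP Dr).
have sa : spc a (fun=> alpha).
  by apply: spec_ext (spec_tofrac _ _ _) => r _; rewrite eval_q_a.
have sq : spc q (fun r => r).
  by apply: spec_ext (spec_tofrac _ _ _) => r _; rewrite eval_q_q.
have sX m := spec_exp m sq; have sX2 := sX 2; have sX6 := sX 6.
have saq : spc (a * q) (fun r => alpha * r) by apply: spec_mul.
have sqa : spc (q / a) (fun r => r / alpha) by apply: spec_div.
have saq6 : spc (a * q ^+ 6) (fun r => alpha * r ^+ 6) by apply: spec_mul.
have sqa6 : spc (q ^+ 6 / a) (fun r => r ^+ 6 / alpha) by apply: spec_div.
have sb m : spc (bval q m) (fun r => bval r m).
  apply: spec_div.
  - by move=> r Dr; rewrite expf_neq0 //; apply/prodf_neq0 => i _; apply: D_opp.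
  - rewrite /q -rmorph_qbin; apply: spec_ext (spec_tofrac _ _ _) => r _.
    by rewrite rmorph_qbin eval_q_q.
  apply/spec_exp/spec_prod => i.
  by apply: (spec_add Dr0); [apply: spec_1|apply: sX].
have sqint m : spc (qint q m) (fun r => qint r m).
  by apply: (spec_sum Dr0) => i; apply: sX.
apply: spec_mul (sX _); apply: spec_mul (sqint _); apply: spec_mul (sb _).
apply: spec_div.
- move=> r Dr; rewrite mulf_neq0 //; apply/prodf_neq0 => i _.
    by rewrite -exprM -mulrA -exprD subr_eq0 eq_sym D_den.
  rewrite -exprM mulrAC -exprD subr_eq0 eq_sym; apply: contra (D_inv r Dr i) => /eqP E.
  by rewrite -[alpha]mul1r -E divfK.
- exact: spec_mul (spec_qpoch Dr0 k saq sX2) (spec_qpoch Dr0 k sqa sX2).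
- exact: spec_mul (spec_qpoch Dr0 k saq6 sX6) (spec_qpoch Dr0 k sqa6 sX6).
Qed.

Lemma spec_difference :
  spc (\sum_(k < n) a_q a q k - q ^- (n - 1) * qint q n ^+ 2) (fun=> 0).
Proof.
have [r0 Dr0] := iroot_ex.
have two0 : (2%:R : L) != 0 by apply: natr_closed_neq0.
have sq : spc q (fun r => r).
  by apply: spec_ext (spec_tofrac _ _ _) => r _; rewrite eval_q_q.
have sc k : spc (c_q a q k) (fun r => cterm alpha r (bval r) k).
  by rewrite c_q_cterm; [apply: spec_cterm|apply: q_frac_opp|apply: q_frac_nonroot].
have /spec_ext : spc (\sum_(k < n) a_q a q k - q ^- (n - 1) * qint q n ^+ 2)
  (fun r => \sum_(k < n) \sum_(j < k.+1) cterm alpha r (bval r) j * cterm alpha r (bval r) (k - j)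
     - r ^- (n - 1) * qint r n ^+ 2); last first.
  apply=> r Dr.
  exact (sum_root_eq0 n_gt0 n_co6 alpha_neq0 alpha_nonroot two0 (modulus_rootP Dr)).
apply: (spec_add Dr0).
  by apply: (spec_sum Dr0) => k; apply: (spec_sum Dr0) => j; exact: spec_mul (sc _) (sc _).
apply: spec_opp; apply: spec_mul.
  apply: spec_inv; last exact: spec_exp sq.
  by move=> r Dr; apply/expf_neq0/(root_neq0 n_gt0 alpha_neq0 (modulus_rootP Dr)).
by apply: spec_exp; apply: (spec_sum Dr0) => i; exact: spec_exp sq.
Qed.

Lemma frac_eqmod_spec (X Y : {fraction Zaq}) :
  spc (X - Y) (fun=> 0) -> frac_eqmod X Y (modulus n).
Proof.
have [r0 Dr0] := iroot_ex; move=> [A [B [xE sAB]]].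
have B0 : B != 0 by rewrite -tofrac_eq0; apply: (@spec_neq0 _ _ _ eval_q _ Dr0) => r /sAB[].
have P0 : modulus n != 0.
  apply/eqP => P0; have PE : modulus n = 0%:P * 0 by rewrite mulr0.
  have [u /eqP] := modulus_dvd_const n_gt0 PE.
  by rewrite mul0r eq_sym oner_eq0.
have [|c [c0 PcA]] := @dvd_clear_denom (modulus n) A P0.
  by apply: modulus_dvd => r /sAB[_ ->]; rewrite mul0r.
have cP0 : c%:P != 0 :> Zaq by rewrite polyC_eq0.
exists (c%:P * A), (c%:P * B); split=> //; first by rewrite mulf_neq0.
  by rewrite xE !rmorphM -mulf_div divff ?mul1r // tofrac_eq0.
move=> d [e PE] [e' BE].
have d0 : d != 0 by apply/eqP => d0; move: P0; rewrite PE d0 mul0r eqxx.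
(* A common divisor of positive degree in [q] has a root in [L], which is a root of the modulus but
   not of [c * B]. A constant one is a unit by [modulus_dvd_const]. *)
case: (ltnP 1 (size d)) => [d_gt1|d_le1].
  have /closed_rootP[r rd] : size (map_poly iota d) != 1%N.
    by rewrite size_map_iota; case: (size d) d_gt1 => [|[]].
  have dr : eval_q r d = 0 by apply/eqP.
  have Pr : iroot r by rewrite /iroot PE rmorphM dr mul0r.
  have [Br _] := sAB r Pr; have := congr1 (eval_q r) BE.
  rewrite !rmorphM dr mul0r => /eqP; rewrite mulf_eq0 (negPf Br) orbF.
  by rewrite [eval_q r _]/= /horner_eval map_polyC hornerC iota_eq0 (negPf c0).
have dE := size1_polyC d_le1; rewrite dE in PE *.
have [u du] := modulus_dvd_const n_gt0 PE.
by apply/unitrPr; exists u%:P; rewrite -polyCM du.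
Qed.

End Assembly.

Theorem theorem3 (n : nat) (n_gt0 : (0 < n)%N) (n_coprime6 : coprime n 6) :
  let a : {fraction Zaq} := FracField.tofrac a_var in
  let q : {fraction Zaq} := FracField.tofrac q_var in
  frac_eqmod
    (\sum_(k < n) a_q a q k)
    (q ^- (n - 1) * qint q n ^+ 2)
    (qint q_var n * (1 - a_var * q_var ^+ n) * (a_var - q_var ^+ n)).
Proof.
have [L [iota iota_inj]] := poly_int_closed_ext.
exact: (frac_eqmod_spec iota_inj n_gt0 (spec_difference iota_inj n_gt0 n_coprime6)).
Qed.
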